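(* Let $X$ be a Banach space and $\{T(t)\}_{t\ge0}$ a bounded $C_0$-semigroup on $X$ with sun-dual semigroup $\{T^\odot(t)\}_{t\ge0}$ on $X^\odot$. Suppose the $w^*$-closure $\mathcal T^\odot$ of $\{T^\odot(t)\}_{t\ge0}$ in $L(X^\odot)$ is abelian, let $P$ be a minimal idempotent of $\mathcal T^\odot$, $X^\odot_a:=PX^\odot$, and let $x^\odot\in X^\odot_a$. Then the following are equivalent: (1) the $\sigma(X^\odot,X)$-closure of $O(x^\odot)=\{T^\odot(t)x^\odot:t\ge0\}$ is norm separable; (2) $x^\odot\in X^\odot_{uds}$; (3) $O(x^\odot)$ is relatively norm compact.
   Context: $X^\odot:=\{x^*\in X^*:\|T^*(t)x^*-x^*\|\to0 \text{ as } t\to0\}$ and $T^\odot(t):=T^*(t)|_{X^\odot}$. For $U_\alpha,U\in L(X^\odot)$, $w^*\text{-}\lim_\alpha U_\alpha=U$ means $\langle x,U_\alpha y\rangle\to\langle x,Uy\rangle$ for all $x\in X,y\in X^\odot$; the $w^*$-closure $\mathcal T^\odot$ of $\{T^\odot(t)\}$ consists of operators on $X^\odot$ and is a compact semigroup under composition. An idempotent $P\in\mathcal T^\odot$ is minimal if for every idempotent $Q\in\mathcal T^\odot$ with $PQ=Q$ one has $QP=P$. $X^\odot_{uds}$ is the norm-closed linear span of those $y\in X^\odot$ for which there is $\lambda:\mathcal T^\odot\to\mathbb C$ with $|\lambda(U)|=1$ and $Uy=\lambda(U)y$ for all $U\in\mathcal T^\odot$. *)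

(* Defs.v *)
From HB Require Import structures.
From mathcomp Require Import all_boot all_order all_algebra.
From mathcomp Require Import complex.
From mathcomp Require Import all_classical all_reals all_analysis.
Set Implicit Arguments. Unset Strict Implicit. Unset Printing Implicit Defensive.
Import Order.TTheory GRing.Theory Num.Theory.
Import numFieldNormedType.Exports.
Local Open Scope classical_set_scope.
Local Open Scope ring_scope.
Local Open Scope complex_scope.

Section Defs.
Variables (R : realType) (X : completeNormedModType R[i]).
Local Notation K := R[i].
Local Notation fX := (X -> K).

Definition dualel (y : fX) : Prop :=
  (forall (a : K) (u v : X), y (a *: u + v) = a * y u + y v) /\
  (* continuity of y : X -> C, epsilon-delta (R[i] carries no topology instance here) *)
  (forall (u : X) (e : K), 0 < e -> exists2 d : K, 0 < d &
     forall v : X, `|v - u| < d -> `|y v - y u| < e).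

(* ||y - z||_{X^*} <= e  (dual norm, written out as the sup bound). *)
Definition ddist_le (y z : fX) (e : K) : Prop :=
  forall u : X, `|y u - z u| <= e * `|u|.

Definition bounded_C0_semigroup (T : R -> X -> X) : Prop :=
  [/\ forall t, 0 <= t ->
        (forall (a : K) (u v : X), T t (a *: u + v) = a *: T t u + T t v) /\
        continuous (T t),
      forall u, T 0 u = u,
      forall s t, 0 <= s -> 0 <= t -> forall u, T (s + t) u = T s (T t u),
      forall u, T^~ u @ at_right 0 --> u &
      (exists M : K, forall t, 0 <= t -> forall u, `|T t u| <= M * `|u|) ].

Definition Tstar (T : R -> X -> X) (t : R) (y : fX) : fX := fun u => y (T t u).

Definition sun (T : R -> X -> X) (y : fX) : Prop :=
  dualel y /\
  forall e : K, 0 < e -> exists d : R, 0 < d /\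
    forall t, 0 < t < d -> ddist_le (Tstar T t y) y e.

Definition Lsun (T : R -> X -> X) (U : fX -> fX) : Prop :=
  [/\ forall y, sun T y -> sun T (U y),
      forall (a : K) y z, sun T y -> sun T z ->
        U (fun u => a * y u + z u) = (fun u => a * U y u + U z u) &
      (exists M : K, forall y, sun T y -> forall c : K,
        ddist_le y (fun=> 0) c -> ddist_le (U y) (fun=> 0) (M * c)) ].

(* w^*-closure of {T^sun(t) : t >= 0} in L(X^sun): U lies in every basic
   neighbourhood {V : |<x_i, V y_i> - <x_i, U y_i>| < e, i < n}
   of the topology  <x, U_a y> -> <x, U y>  (x in X, y in X^sun). *)
Definition Tcl (T : R -> X -> X) (U : fX -> fX) : Prop :=
  Lsun T U /\
  forall (n : nat) (xs : 'I_n -> X) (ys : 'I_n -> fX) (e : K),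
    (forall i, sun T (ys i)) -> 0 < e ->
    exists t : R, 0 <= t /\ forall i, `|U (ys i) (xs i) - Tstar T t (ys i) (xs i)| < e.

Definition Tcl_abelian (T : R -> X -> X) : Prop :=
  forall U V, Tcl T U -> Tcl T V -> forall y, sun T y -> U (V y) = V (U y).

Definition Tcl_idempotent (T : R -> X -> X) (P : fX -> fX) : Prop :=
  Tcl T P /\ forall y, sun T y -> P (P y) = P y.

Definition Tcl_minimal_idempotent (T : R -> X -> X) (P : fX -> fX) : Prop :=
  Tcl_idempotent T P /\
  forall Q, Tcl_idempotent T Q ->
    (forall y, sun T y -> P (Q y) = Q y) ->
    (forall y, sun T y -> Q (P y) = P y).

Definition sun_a (T : R -> X -> X) (P : fX -> fX) (x : fX) : Prop :=
  exists y, sun T y /\ x = P y.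

Definition sg_orbit (T : R -> X -> X) (x : fX) : set fX :=
  [set z | exists t, 0 <= t /\ z = Tstar T t x].

Definition wcl (T : R -> X -> X) (S : set fX) : set fX :=
  [set z | sun T z /\
    forall (n : nat) (xs : 'I_n -> X) (e : K), 0 < e ->
      exists2 s, S s & forall i, `|z (xs i) - s (xs i)| < e].

Definition ncl (T : R -> X -> X) (S : set fX) : set fX :=
  [set z | sun T z /\ forall e : K, 0 < e -> exists2 s, S s & ddist_le z s e].

Definition norm_separable (S : set fX) : Prop :=
  exists d : nat -> fX, (forall k, S (d k)) /\
    forall z, S z -> forall e : K, 0 < e -> exists k, ddist_le z (d k) e.

Definition nopen (T : R -> X -> X) (G : set fX) : Prop :=
  forall g, G g -> exists2 e : K, 0 < e &
    forall h, sun T h -> ddist_le h g e -> G h.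

Definition ncompact (T : R -> X -> X) (A : set fX) : Prop :=
  A `<=` sun T /\
  forall F : set (set fX), (forall G, F G -> nopen T G) ->
    A `<=` \bigcup_(G in F) G ->
    exists (n : nat) (Gs : 'I_n -> set fX),
      (forall i, F (Gs i)) /\ A `<=` \bigcup_(i in setT) Gs i.

Definition rel_ncompact (T : R -> X -> X) (S : set fX) : Prop :=
  ncompact T (ncl T S).

Definition uni_eigen (T : R -> X -> X) (y : fX) : Prop :=
  sun T y /\ exists lam : (fX -> fX) -> K,
    forall U, Tcl T U -> `|lam U| = 1 /\ U y = (fun u => lam U * y u).

Definition sun_uds (T : R -> X -> X) (x : fX) : Prop :=
  sun T x /\
  forall e : K, 0 < e -> exists (n : nat) (c : 'I_n -> K) (ys : 'I_n -> fX),
    (forall i, uni_eigen T (ys i)) /\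
    ddist_le x (fun u => \sum_(i < n) c i * ys i u) e.

End Defs.

(* Main.v *)
Require Import Defs.
From mathcomp Require Import all_boot all_order all_algebra.
From mathcomp Require Import complex.
From mathcomp Require Import all_classical all_reals all_analysis.
From mathcomp Require Import ring lra.
Import Order.TTheory GRing.Theory Num.Theory.
Import numFieldNormedType.Exports.
Set Implicit Arguments. Unset Strict Implicit. Unset Printing Implicit Defensive.
Local Open Scope classical_set_scope.
Local Open Scope ring_scope.

(** Each of (1), (2) and (3) is equivalent to total boundedness of the orbit of [x].

    Separability implies total boundedness by a Baire category argument in the w*-compact set [wcl (O x)], the
    orbit of [x] under the closure of the semigroup: some nonempty w*-open set of it has small norm diameter, and
    its preimages under the operators of the semigroup cover the set. Those operators are bounded below on the
    orbit because each [U P] has an inverse in the closure; this comes from an idempotent in the closed ideal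
    generated by [P U], and minimality of [P].

    Total boundedness yields eigenvectors by finite Fourier analysis. On a grid of [N] times of mesh [h], let [A]
    be the set of the times in the first half with [T^*(s h) x] close to [x]; it has positive density, uniformly
    in [N] and [h]. The average of [T^*((s + s') h) x] over [s, s' in A] is close to [x], and by Parseval it is
    also close to a combination of a bounded number of Fourier averages of the orbit. As [h -> 0] and [N h -> oo],
    the w*-limits of these along an ultrafilter are eigenvectors of the semigroup. *)

(** * Fourier analysis on a finite cyclic group *)

Section FiniteFourier.
Variable C : numClosedFieldType.

Lemma normr_prim_root n (w : C) : n.-primitive_root w -> `|w| = 1.
Proof.
move=> pw; have n_gt0 := prim_order_gt0 pw.
by apply/eqP; rewrite -(@pexpr_eq1 _ _ n) // -normrX (prim_expr_order pw) normr1.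
Qed.

Lemma prim_root_orthogonal n (w : C) p q :
  n.-primitive_root w -> (p < n)%N -> (q < n)%N ->
  \sum_(j < n) w ^+ (j * p) * (w ^+ (j * q))^* = if p == q then n%:R else 0.
Proof.
move=> pw pn qn; have nw := normr_prim_root pw.
have w0 : w != 0 by rewrite -normr_gt0 nw.
have -> : \sum_(j < n) w ^+ (j * p) * (w ^+ (j * q))^* =
    \sum_(j < n) (w ^+ p / w ^+ q) ^+ j.
  apply: eq_bigr => j _.
  rewrite expr_div_n -!exprM (mulnC p) (mulnC q).
  by rewrite [X in _ = _ * X]invC_norm normrX nw !expr1n invr1 mul1r.
case: (eqVneq p q) => [->|pq].
  rewrite divff ?expf_neq0 // (eq_bigr (fun=> 1)) => [|j _]; last by rewrite expr1n.
  by rewrite sumr_const card_ord.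
set z := w ^+ p / w ^+ q.
have z1 : z != 1.
  apply/eqP => /divr1_eq /eqP; rewrite (eq_prim_root_expr pw) !modn_small //.
  exact/negP.
apply: (mulfI (x := z - 1)); first by rewrite subr_eq0.
rewrite -subrX1 mulr0 expr_div_n -!exprM !(mulnC _ n) !exprM (prim_expr_order pw).
by rewrite !expr1n divr1 subrr.
Qed.

(** Only the diagonal terms survive orthogonality. The kernel [u] is arbitrary because both the
    characters and their conjugates are used. *)
Lemma parseval n (u : 'I_n -> 'I_n -> C) (g : 'I_n -> C) :
  (forall s t, \sum_(j < n) u j s * (u j t)^* = if s == t then n%:R else 0) ->
  \sum_(j < n) `|\sum_(s < n) g s * u j s| ^+ 2 = n%:R * \sum_(s < n) `|g s| ^+ 2.
Proof.
move=> orth.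
under eq_bigr => j _.
  rewrite normCK rmorph_sum big_distrlr /=.
  over.
rewrite exchange_big /= mulr_sumr; apply: eq_bigr => s _.
rewrite exchange_big /= (bigD1 s) //= [X in _ + X]big1 ?addr0 => [|t ts].
  under eq_bigr => j _ do rewrite rmorphM mulrACA.
  by rewrite -mulr_sumr orth eqxx -normCK mulrC.
under eq_bigr => j _ do rewrite rmorphM mulrACA.
by rewrite -mulr_sumr orth eq_sym (negPf ts) mulr0.
Qed.

(** Cauchy-Schwarz against the constant 1, by Lagrange's identity; the [r i] are real since
    nonnegative, so the squares of their differences are nonnegative in [C]. *)
Lemma sqr_sum_le n (r : 'I_n -> C) : (forall i, 0 <= r i) ->
  (\sum_i r i) ^+ 2 <= n%:R * \sum_i r i ^+ 2.
Proof.
move=> r0; rewrite -subr_ge0.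
have -> : n%:R * (\sum_i r i ^+ 2) - (\sum_i r i) ^+ 2 =
    2^-1 * \sum_i \sum_j (r i - r j) ^+ 2.
  set S := \sum_i r i; set Q := \sum_i r i ^+ 2.
  have -> : \sum_i \sum_j (r i - r j) ^+ 2 =
      \sum_i (n%:R * r i ^+ 2 - 2 * S * r i + Q).
    apply: eq_bigr => i _; rewrite mulr_natl -[in X in X - _](card_ord n) -sumr_const.
    rewrite -mulrA [S * _]mulrC [r i * _]mulr_sumr mulr_sumr -sumrB -big_split /=.
    by apply: eq_bigr => j _; ring.
  rewrite big_split sumrB /= sumr_const card_ord -!mulr_sumr -/S -/Q -mulr_natl.
  by field.
rewrite mulr_ge0 ?invr_ge0 ?ler0n // sumr_ge0 // => i _; rewrite sumr_ge0 // => j _.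
by rewrite real_exprn_even_ge0 // rpredB // ger0_real.
Qed.

Section Approximation.
Variables (h : nat) (w : C) (A : {set 'I_h}).
Hypothesis pw : (2 * h).-primitive_root w.
Local Notation N := (2 * h)%N.

Definition fourier_coef (j : nat) : C := \sum_(s in A) (w ^+ (j * s))^*.
Local Notation a := fourier_coef.

Let nw : `|w| = 1. Proof. exact: normr_prim_root pw. Qed.
Let N_gt0 : (0 < N)%N. Proof. exact: prim_order_gt0 pw. Qed.
Let hN : (h <= N)%N. Proof. by rewrite leq_pmull. Qed.

(** [A] lies in the first half of the cyclic group of order [2 * h], so [s + s'] never wraps around.
    Inverting the transform of [f] at [s + s'] and summing over the pairs collects the characters
    into [a j ^+ 2]. *)
Lemma fourier_inversion (f : nat -> C) :
  \sum_(s in A) \sum_(s' in A) f (s + s')%N =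
  N%:R^-1 * \sum_(j < N) a j ^+ 2 * \sum_(t < N) w ^+ (j * t) * f t.
Proof.
have N0 : N%:R != 0 :> C by rewrite pnatr_eq0 -lt0n.
apply: (mulfI N0); rewrite mulVKf // mulr_sumr.
transitivity (\sum_(s in A) \sum_(s' in A) \sum_(j < N)
   ((w ^+ (j * s))^* * (w ^+ (j * s'))^*) * \sum_(t < N) w ^+ (j * t) * f t).
  apply: eq_bigr => s _; rewrite mulr_sumr; apply: eq_bigr => s' _.
  have ss'N : (s + s' < N)%N by rewrite mul2n -addnn -addSn leq_add // ltnW.
  under eq_bigr => j _ do rewrite -rmorphM -exprD -mulnDr mulr_sumr.
  rewrite exchange_big /= (bigD1 (Ordinal ss'N)) //= [X in _ + X]big1 ?addr0.
    under eq_bigr => j _ do rewrite mulrA (mulrC (_^*)).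
    by rewrite -mulr_suml (prim_root_orthogonal pw) // eqxx.
  move=> t tne; under eq_bigr => j _ do rewrite mulrA (mulrC (_^*)).
  rewrite -mulr_suml (prim_root_orthogonal pw) //.
  by case: eqP => [e|_]; rewrite ?mul0r //; move/eqP: tne; case; apply: val_inj.
under eq_bigr => s _ do rewrite exchange_big /=.
rewrite exchange_big /=; apply: eq_bigr => j _.
rewrite expr2 {1}/a mulr_suml mulr_suml; apply: eq_bigr => s _.
by rewrite -mulr_suml -mulr_sumr.
Qed.

Lemma fourier_coef_le j : `|a j| <= #|A|%:R.
Proof.
apply: le_trans (ler_norm_sum _ _ _) _.
rewrite (eq_bigr (fun=> 1)) ?sumr_const // => s _.
by rewrite norm_conjC normrX nw expr1n.
Qed.

Lemma sum_fourier_coef : \sum_(j < N) `|a j| ^+ 2 = N%:R * #|A|%:R.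
Proof.
pose A' : {set 'I_N} := [set widen_ord hN s | s in A]%SET.
have wi : injective (widen_ord hN) by move=> x y [/val_inj].
have aE (j : 'I_N) : a j = \sum_(s < N) (s \in A')%:R * (w ^+ (j * s))^*.
  rewrite /a (eq_bigr (fun s => if s \in A' then (w ^+ (j * s))^* else 0)); last first.
    by move=> s _; case: ifP; rewrite ?mul1r ?mul0r.
  by rewrite -big_mkcond big_imset //= => x y _ _; apply: wi.
under eq_bigr => j _ do rewrite aE.
rewrite (parseval (u := fun j s : 'I_N => (w ^+ (j * s))^*)); last first.
  move=> s t; under eq_bigr => j _ do rewrite conjCK mulrC.
  rewrite (prim_root_orthogonal pw) //.
  by case: (eqVneq s t) => [->|/eqP st]; rewrite ?eqxx //; case: eqP => // /val_inj e; case: st.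
congr (_ * _); rewrite -(card_imset _ wi) -sumr_const [RHS]big_mkcond /=.
by apply: eq_bigr => s _; case: ifP => _; rewrite ?normr1 ?normr0 ?expr1n ?expr0n.
Qed.

(* The Fourier coefficients of [1_A * 1_A] are the [a j ^+ 2]; discarding the small ones costs little by
   Parseval, since [sum |a j|^4 <= max |a j|^2 * sum |a j|^2], while the number of large ones is bounded
   independently of [h]. *)
Lemma fourier_approximation (c eta : C) (m : nat) :
  0 < c -> 0 < eta -> c * N%:R <= #|A|%:R -> (eta ^+ 2 * c ^+ 3)^-1 <= m%:R ->
  exists (j : 'I_m -> nat) (k : 'I_m -> C), (forall i, `|k i| <= 1) /\
  forall (f : nat -> C) (B : C), (forall t, (t < N)%N -> `|f t| <= B) ->
  `|#|A|%:R ^- 2 * (\sum_(s in A) \sum_(s' in A) f (s + s')%N) -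
    \sum_(i < m) k i * (N%:R^-1 * \sum_(t < N) w ^+ (j i * t) * f t)| <= eta * B.
Proof.
move=> c0 e0 cA mE.
have N0 : 0 < N%:R :> C by rewrite ltr0n.
have A0 : 0 < #|A|%:R :> C by apply: lt_le_trans cA; rewrite mulr_gt0.
(* [th * N ^+ 2] separates large from small [|a j| ^+ 2]: Parseval allows at most [th^-1] large
   ones, and the density [c], used three times, brings the contribution of the small ones below
   [eta * B]. *)
set th := eta ^+ 2 * c ^+ 3 in mE.
have th0 : 0 < th by rewrite mulr_gt0 // exprn_gt0.
pose J := [set j : 'I_N | th * N%:R ^+ 2 <= `|a j| ^+ 2]%SET.
have Jm : (#|J| <= m)%N.
  rewrite -(ler_nat C); apply: le_trans mE.
  rewrite -[leRHS]mul1r ler_pdivlMr // -(ler_pM2r (exprn_gt0 2 N0)) mul1r.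
  rewrite -mulrA mulr_natl -sumr_const.
  apply: le_trans (_ : \sum_(j in J) `|a j| ^+ 2 <= _).
    by apply: ler_sum => j; rewrite inE.
  apply: le_trans (_ : \sum_(j < N) `|a j| ^+ 2 <= _).
    rewrite [leRHS](bigID (mem J)) /= lerDl; apply: sumr_ge0 => j _.
    exact: exprn_ge0.
  rewrite sum_fourier_coef expr2 ler_pM2l // ler_nat (leq_trans _ hN) //.
  by rewrite -[leqRHS]card_ord max_card.
pose F (f : nat -> C) (j : nat) := N%:R^-1 * \sum_(t < N) w ^+ (j * t) * f t.
(* A list of [J], padded with zero weights up to the prescribed length [m]. *)
pose jj (i : 'I_m) : nat := nth 0%N [seq val j | j in J] i.
pose kk (i : 'I_m) : C := if (i < #|J|)%N then #|A|%:R ^- 2 * a (jj i) ^+ 2 else 0.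
exists jj, kk; split=> [i|f B fB].
  rewrite /kk; case: ifP => _; last by rewrite normr0.
  rewrite normrM normfV !normrX normr_nat mulrC ler_pdivrMr ?exprn_gt0 // mul1r.
  by rewrite lerXn2r ?nnegrE // fourier_coef_le.
have B0 : 0 <= B by apply: le_trans (fB 0%N N_gt0).
have -> : \sum_(i < m) kk i * F f (jj i) =
    \sum_(j in J) #|A|%:R ^- 2 * a j ^+ 2 * F f j.
  rewrite -(big_image _ _ val _ (fun j : nat => #|A|%:R ^- 2 * a j ^+ 2 * F f j)).
  rewrite (big_nth 0%N) big_mkord size_image.
  rewrite (big_ord_widen m (fun i => #|A|%:R ^- 2 *
     a (nth 0%N [seq val j | j in J] i) ^+ 2 * F f (nth 0%N [seq val j | j in J] i))) //.
  rewrite [RHS]big_mkcond; apply: eq_bigr => i _.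
  by rewrite /kk; case: ifP; rewrite ?mul0r.
rewrite fourier_inversion.
(* The error is a pairing of [f] with the transform [r] of the small coefficients, so it is
   controlled by the l^1 norm of [r], which Cauchy-Schwarz and Parseval bound. *)
set r := fun t : 'I_N => \sum_(j < N) (if j \in J then 0 else a j ^+ 2) * w ^+ (t * j).
have -> : #|A|%:R ^- 2 * (N%:R^-1 * (\sum_(j < N) a j ^+ 2 *
      (\sum_(t < N) w ^+ (j * t) * f t))) -
    \sum_(j in J) #|A|%:R ^- 2 * a j ^+ 2 * F f j =
    #|A|%:R ^- 2 * (N%:R^-1 * (\sum_(t < N) f t * r t)).
  have -> : \sum_(t < N) f t * r t =
     \sum_(j < N | j \notin J) a j ^+ 2 * (\sum_(t < N) w ^+ (j * t) * f t).
    under eq_bigr => t _ do rewrite /r mulr_sumr.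
    rewrite exchange_big [RHS]big_mkcond /=; apply: eq_bigr => j _.
    case: ifP => jJ /=; first by rewrite big1 // => t _; rewrite mul0r mulr0.
    rewrite mulr_sumr; apply: eq_bigr => t _.
    by rewrite (mulnC t) mulrC mulrA.
  rewrite (bigID (mem J)) /= !mulrDr.
  under [X in _ - X]eq_bigr => j _ do rewrite /F mulrCA -mulrA.
  rewrite -!mulr_sumr.
  by set x := \sum_(j in J) _; rewrite [X in _ - X]mulrCA addrAC subrr add0r.
rewrite !normrM !normfV normrX !normr_nat mulrCA ler_pdivrMl //.
rewrite ler_pdivrMl ?exprn_gt0 //.
apply: le_trans (_ : B * \sum_(t < N) `|r t| <= _).
  apply: le_trans (ler_norm_sum _ _ _) _.
  rewrite mulr_sumr; apply: ler_sum => t _.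
  by rewrite normrM ler_wpM2r ?fB.
rewrite [leLHS]mulrC !mulrA; apply: ler_wpM2r => //.
have thN0 : 0 <= th * N%:R ^+ 2 by rewrite mulr_ge0 ?exprn_ge0 // ltW.
have rhs0 : 0 <= #|A|%:R ^+ 2 * N%:R * eta by rewrite !mulr_ge0 // ltW.
rewrite -(@ler_pXn2r _ 2) ?nnegrE ?sumr_ge0 //.
apply: le_trans (sqr_sum_le _) _ => //.
rewrite (parseval (u := fun t j : 'I_N => w ^+ (t * j))); last first.
  move=> s t; rewrite (prim_root_orthogonal pw) //.
have small : \sum_(s < N) `|if s \in J then 0 else a s ^+ 2| ^+ 2 <=
    th * N%:R ^+ 2 * (N%:R * #|A|%:R).
  rewrite -sum_fourier_coef mulr_sumr; apply: ler_sum => j _.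
  case: ifPn => jJ.
    by rewrite normr0 expr0n /= mulr_ge0 // exprn_ge0.
  rewrite normrX expr2 ler_wpM2r ?exprn_ge0 // ltW //.
  by move: jJ; rewrite inE -real_ltNge ?ger0_real ?exprn_ge0.
rewrite mulrA; apply: le_trans (ler_wpM2l (mulr_ge0 (ltW N0) (ltW N0)) small) _.
have cA3 : (c * N%:R) ^+ 3 <= #|A|%:R ^+ 3.
  by rewrite lerXn2r ?nnegrE ?(ltW A0) // mulr_ge0 ?(ltW c0) ?(ltW N0).
rewrite /th.
have -> : N%:R * N%:R * (eta ^+ 2 * c ^+ 3 * N%:R ^+ 2 * (N%:R * #|A|%:R)) =
   (eta ^+ 2 * N%:R ^+ 2 * #|A|%:R) * (c * N%:R) ^+ 3 :> C by ring.
have -> : (#|A|%:R ^+ 2 * N%:R * eta) ^+ 2 = 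
   (eta ^+ 2 * N%:R ^+ 2 * #|A|%:R) * #|A|%:R ^+ 3 :> C by ring.
by apply: ler_wpM2l => //; rewrite !mulr_ge0 ?exprn_ge0 ?(ltW A0) ?(ltW e0).
Qed.
End Approximation.

(** Repeated square roots of -1 reach [w] with [w ^+ (2 ^ n) = -1]; its order is a power of 2, and a
    smaller exponent would give [-1 = 1]. *)
Lemma prim_root_two_power n : exists w : C, (2 ^ n.+1).-primitive_root w.
Proof.
have [w wE] : exists w : C, w ^+ (2 ^ n) = -1.
  elim: n => [|n [w wE]]; first by exists (-1).
  by exists (sqrtC w); rewrite expnS exprM sqrtCK.
exists w.
have w1 : w ^+ (2 ^ n.+1) = 1 by rewrite expnSr exprM wE sqrrN expr1n.
have [d pd dn] := prim_order_exists (expn_gt0 2 n.+1) w1.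
have /(dvdn_pfactor _ _ (isT : prime 2)) [k kn dE] := dn.
suff: k = n.+1 by move=> <-; rewrite -dE.
apply/eqP; rewrite eqn_leq kn leqNgt; apply/negP => kn'.
have : w ^+ (2 ^ n) = 1.
  by apply/eqP; rewrite -(prim_order_dvd pd) dE dvdn_exp2l.
by rewrite wE => /eqP; rewrite eqNr oner_eq0.
Qed.

End FiniteFourier.

(** * Limits along ultrafilters *)

Local Open Scope complex_scope.

Lemma ultrafilter_of_fip (I T : Type) (A : I -> set T) :
  (forall n (s : 'I_n -> I), exists x, forall k, A (s k) x) ->
  exists F : set_system T, UltraFilter F /\ forall i, F (A i).
Proof.
move=> fip.
pose G : set_system T :=
  [set B | exists n (s : 'I_n -> I), [set x | forall k, A (s k) x] `<=` B].
have GP : ProperFilter G.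
  split; first by case=> n [s sub0]; have [x /sub0] := fip n s.
  split; first by exists 0%N, (fun k : 'I_0 => False_rect I (notF (ltn_ord k))).
  - move=> B C [n [s sB]] [m [t tC]].
    exists (n + m)%N, (fun k => match fintype.split k with inl i => s i | inr j => t j end).
    move=> x xst; split.
      by apply: sB => i; have := xst (lshift m i); rewrite (unsplitK (inl i)).
    by apply: tC => j; have := xst (rshift n j); rewrite (unsplitK (inr j)).
  - by move=> B C BC [n [s sB]]; exists n, s => x /sB /BC.
have [F [FU GF]] := ultraFilterLemma GP.
by exists F; split=> // i; apply: GF; exists 1%N, (fun=> i) => x /(_ ord0).
Qed.

Lemma ultra_finite_union (T : Type) (F : set_system T) n (A : 'I_n -> set T) :
  UltraFilter F -> F [set t | exists k, A k t] -> exists k, F (A k).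
Proof.
move=> FU FA; apply/not_existsP => nF.
have : F [set t | forall k, ~ A k t].
  by apply: filter_forall => k; have [/nF|] := in_ultra_setVsetC (A k) FU.
move=> /(filterI FA) /filter_ex[t [/= [k Ak] nA]]; exact: nA Ak.
Qed.

Section UltraLimit.
Variable R : realType.
Local Notation K := R[i].

Lemma ltr0_complex (e : K) : 0 < e -> exists2 r : R, 0 < r & e = r%:C.
Proof.
move=> e0; exists (complex.Re e); last by rewrite RRe_real // gtr0_real.
by move: e0; rewrite ltcE => /andP[].
Qed.

Lemma normc_le_ReIm (z : K) : `|z| <= (`|complex.Re z| + `|complex.Im z|)%:C.
Proof.
rewrite normc_def lecR -(@ler_pXn2r _ 2) ?nnegrE ?sqrtr_ge0 ?addr_ge0 //.
rewrite sqr_sqrtr ?addr_ge0 ?sqr_ge0 // sqrrD !real_normK ?num_real //.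
by rewrite lerD2r lerDl mulrn_wge0 // mulr_ge0.
Qed.

Lemma normc_ge_Im (z : K) : `|complex.Im z|%:C <= `|z|.
Proof.
by rewrite -normrN -ReiNIm (le_trans (normc_ge_Re _)) // normrM normCi mulr1.
Qed.

Lemma invn_lt (e : K) : 0 < e -> exists n, n.+1%:R^-1 < e.
Proof.
move=> /ltr0_complex[r r0 ->]; exists (Num.truncn r^-1).
rewrite (_ : _^-1 = (((Num.truncn r^-1).+1%:R)^-1)%:C); last by rewrite fmorphV rmorph_nat.
by rewrite ltcR invf_plt ?posrE // truncnS_gt.
Qed.

Section Filter.
Variables (I : Type) (F : set_system I).

Definition ucvg (f : I -> K) (l : K) := forall e, 0 < e -> F [set i | `|f i - l| < e].

Section Proper.
Context {FF : ProperFilter F}.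

Lemma ucvg_cst l : ucvg (fun=> l) l.
Proof. by move=> e e0; apply: filterE => i /=; rewrite subrr normr0. Qed.

Lemma ucvgD f g l m : ucvg f l -> ucvg g m -> ucvg (fun i => f i + g i) (l + m).
Proof.
move=> fl gm e e0; have e20 : 0 < e / 2 by rewrite divr_gt0.
apply: filterS2 (fl _ e20) (gm _ e20) => i /= fi gi.
by rewrite opprD addrACA (splitr e) (le_lt_trans (ler_normD _ _)) // ltrD.
Qed.

Lemma ucvgM f g l m : ucvg f l -> ucvg g m -> ucvg (fun i => f i * g i) (l * m).
Proof.
move=> fl gm e e0.
have d0 : 0 < e / 2 / (`|m| + 1) by rewrite !divr_gt0 // ltr_wpDl.
have d1 : 0 < e / 2 / (`|l| + 1) by rewrite !divr_gt0 // ltr_wpDl.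
apply: filterS (filterI (filterI (fl _ ltr01) (fl _ d0)) (filterI (gm _ d1) (gm _ ltr01))).
move=> i /= [[fi1 fi] [gi gi1]].
have -> : f i * g i - l * m = (f i - l) * g i + l * (g i - m) by ring.
apply: le_lt_trans (ler_normD _ _) _; rewrite !normrM (splitr e).
have gm1 : `|g i| <= `|m| + 1.
  rewrite -[g i](subrK m) addrC (le_trans (ler_normD _ _)) // lerD2l.
  exact: ltW.
apply: ltr_leD.
  apply: le_lt_trans (ler_wpM2l _ gm1) _ => //.
  by rewrite -ltr_pdivlMr // ltr_wpDl.
apply: le_trans (_ : (`|l| + 1) * `|g i - m| <= _).
  by apply: ler_wpM2r => //; rewrite lerDl.
by rewrite mulrC -ler_pdivlMr ?ltW // ltr_wpDl.
Qed.

Lemma ucvgN f l : ucvg f l -> ucvg (fun i => - f i) (- l).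
Proof.
by move=> fl e /fl; apply: filterS => i /=; rewrite -opprD normrN.
Qed.

Lemma ucvgB f g l m : ucvg f l -> ucvg g m -> ucvg (fun i => f i - g i) (l - m).
Proof. by move=> fl /ucvgN; exact: ucvgD. Qed.

Lemma ucvg_sum n (f : 'I_n -> I -> K) l : (forall k, ucvg (f k) (l k)) ->
  ucvg (fun i => \sum_k f k i) (\sum_k l k).
Proof.
move=> fl; elim: (index_enum _) => [|k s IH].
  have -> : (fun i => \sum_(k <- [::]) f k i) = (fun=> 0) by apply/funext => i; rewrite big_nil.
  by rewrite big_nil; apply: ucvg_cst.
have -> : (fun i => \sum_(j <- k :: s) f j i) = (fun i => f k i + \sum_(j <- s) f j i).
  by apply/funext => i; rewrite big_cons.
by rewrite big_cons; apply: ucvgD.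
Qed.

Lemma ucvg_norm f l : ucvg f l -> ucvg (fun i => `|f i|) `|l|.
Proof.
move=> fl e e0; apply: filterS (fl e e0) => i /=.
exact/le_lt_trans/ler_dist_dist.
Qed.

Lemma ucvg_norm_le f l b : ucvg f l -> F [set i | `|f i| <= b] -> `|l| <= b.
Proof.
move=> fl fb; apply/ler_addgt0Pr => e e0.
have [i /= [fi li]] := filter_ex (filterI fb (fl _ e0)).
rewrite -[l](subrK (f i)) addrC (le_trans (ler_normD _ _)) // lerD // distrC.
exact: ltW.
Qed.

Lemma ucvg_unique f l m : ucvg f l -> ucvg f m -> l = m.
Proof.
move=> fl fm; apply/eqP; rewrite -subr_eq0 -normr_le0.
have := ucvgB fl fm => /ucvg_norm_le; apply.
by apply: filterE => i /=; rewrite subrr normr0.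
Qed.

Lemma ucvg_norm_eq f l b : ucvg f l -> F [set i | `|f i| = b] -> `|l| = b.
Proof.
move=> /ucvg_norm fl fb; apply: ucvg_unique fl _ => e e0.
by apply: filterS fb => i /= ->; rewrite subrr normr0.
Qed.
End Proper.

(** Along [F], real and imaginary parts lie in a compact segment, and a cluster point of an
    ultrafilter is a limit. *)
Lemma ultra_ucvg (f : I -> K) (b : K) : UltraFilter F -> F [set i | `|f i| <= b] -> exists l, ucvg f l.
Proof.
move=> FU fb.
have real_cvg (g : I -> R) : (forall i, `|g i|%:C <= `|f i|) ->
    exists p : R, forall r : R, 0 < r -> F [set i | `|g i - p| < r].
  move=> gf.
  have gb : (g @ F) `[- complex.Re b, complex.Re b]%classic.
    rewrite /fmap /=; apply: filterS fb => i /= fi; rewrite in_itv /= -ler_norml.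
    by move: (le_trans (gf i) fi); rewrite lecE => /andP[].
  have [p [_ pcl]] : exists p : R, _ /\ cluster (g @ F) p :=
    @segment_compact R (- complex.Re b) (complex.Re b) (g @ F) _ gb.
  exists p => r r0; have [//|nF] := in_ultra_setVsetC [set i | `|g i - p| < r] FU.
  have nF' : (g @ F) [set q | ~ `|q - p| < r] by [].
  have pr : nbhs p (ball p r) by apply: nbhsx_ballx.
  have [q [/= nq]] := pcl _ _ nF' pr.
  by rewrite /ball /= distrC => /nq.
have [p pP] := real_cvg _ (fun i => normc_ge_Re (f i)).
have [q qP] := real_cvg _ (fun i => normc_ge_Im (f i)).
exists (p +i* q) => e /ltr0_complex[r r0 ->].
have r20 : 0 < r / 2 by rewrite divr_gt0.
apply: filterS2 (pP _ r20) (qP _ r20) => i /=.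
case: (f i) => a c /= ap cq.
apply: le_lt_trans (normc_le_ReIm _) _; rewrite ltcR /=; lra.
Qed.
End Filter.
End UltraLimit.

(** * The w*-closure of the semigroup *)

Section Semigroup.
Variables (R : realType) (X : completeNormedModType R[i]) (T : R -> X -> X).
Local Notation K := R[i].
Local Notation fX := (X -> K).

Definition linear_form (y : fX) := forall (a : K) (u v : X), y (a *: u + v) = a * y u + y v.

Lemma linear_form0 y : linear_form y -> y 0 = 0.
Proof.
move=> yl; have := yl 1 0 0; rewrite scaler0 addr0 mul1r => /eqP.
by rewrite -[X in X == _]addr0 (inj_eq (addrI _)) eq_sym => /eqP.
Qed.

Lemma linear_formB y u v : linear_form y -> y (u - v) = y u - y v.
Proof. by move=> yl; rewrite -scaleN1r addrC yl mulN1r addrC. Qed.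

Lemma linear_formZ y a u : linear_form y -> y (a *: u) = a * y u.
Proof. by move=> yl; rewrite -[a *: u]addr0 yl linear_form0 // addr0. Qed.

Lemma dualel_bound (y : fX) : dualel y -> exists2 C : K, 0 < C & forall u, `|y u| <= C * `|u|.
Proof.
case=> yl yc; have [d d0 dP] := yc 0 1 ltr01.
exists (2 / d); first by rewrite divr_gt0.
move=> u; have [->|u0] := eqVneq u 0; first by rewrite linear_form0 // !normr0 mulr0.
have nu : 0 < `|u| by rewrite normr_gt0.
(* Rescales [u] to norm [d / 2], inside the ball on which [y] is smaller than 1. *)
pose a := d / 2 / `|u|.
have a0 : 0 < a by rewrite !divr_gt0.
have := dP (a *: u); rewrite (linear_form0 yl) !subr0 (linear_formZ _ _ yl) normrM normrZ.
rewrite (gtr0_norm a0) mulfVK ?gt_eqF // => /(_ _)/ltW.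
rewrite ltr_pdivrMr // ltr_pMr // ltr1n => /(_ isT).
rewrite mulrC -ler_pdivlMr // mul1r => /le_trans; apply.
rewrite le_eqVlt; apply/orP; left; apply/eqP.
by rewrite /a; field; rewrite !gt_eqF.
Qed.

Lemma bounded_dualel y (C : K) : linear_form y -> (forall u, `|y u| <= C * `|u|) -> dualel y.
Proof.
move=> yl yC; split=> // u e e0.
(* [C] carries no sign condition, so [|C| + 1] serves as a positive constant. *)
have C1 : 0 < `|C| + 1 by rewrite ltr_wpDl.
exists (e / (`|C| + 1)); first by rewrite divr_gt0.
move=> v; rewrite ltr_pdivlMr // => vu.
rewrite -linear_formB // (le_lt_trans _ vu) // (le_trans (yC _)) //.
have : 0 <= C * `|v - u| by rewrite (le_trans _ (yC _)).
move=> /ger0_norm <-; rewrite normrM normr_id mulrC ler_wpM2l // lerDl //.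
Qed.

Variable M : K.
Hypothesis M_gt0 : 0 < M.
Hypothesis T_linear : forall t : R, 0 <= t -> forall (a : K) u v, T t (a *: u + v) = a *: T t u + T t v.
Hypothesis T_add : forall s t : R, 0 <= s -> 0 <= t -> forall u, T (s + t) u = T s (T t u).
Hypothesis T_bound : forall t : R, 0 <= t -> forall u, `|T t u| <= M * `|u|.

Lemma T_comm s t u : 0 <= s -> 0 <= t -> T s (T t u) = T t (T s u).
Proof. by move=> s0 t0; rewrite -!T_add // addrC. Qed.

(* [z] inherits from [y] every bound that membership in the sun dual is about; the operators in the closure
   and the Fourier averages of an orbit all produce such [z]. *)
Definition dominated (y z : fX) := [/\ linear_form z,
  (forall C : K, 0 <= C -> (forall v, `|y v| <= C * `|v|) -> forall u, `|z u| <= M * C * `|u|) &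
  (forall t : R, 0 <= t -> forall b : K, 0 <= b -> (forall v, `|y (T t v) - y v| <= b * `|v|) ->
     forall u, `|z (T t u) - z u| <= M * b * `|u|)].

Lemma sun_linear (y : fX) : sun T y -> linear_form y. Proof. by case=> -[]. Qed.

Lemma dominated_sun y z : sun T y -> dominated y z -> sun T z.
Proof.
move=> [yd ys] [zl zb zm]; split.
  have [C C0 yC] := dualel_bound yd.
  by apply: (bounded_dualel zl (zb C (ltW C0) yC)).
move=> e e0; have [d [d0 dP]] := ys (e / M) (divr_gt0 e0 M_gt0).
exists d; split=> // t td; have t0 : 0 <= t by case/andP: td => /ltW.
move=> u; rewrite /Tstar; apply: le_trans (zm t t0 (e / M) _ _ u) _.
- by rewrite divr_ge0 ?ltW.
- by move=> v; apply: dP.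
- by rewrite mulrCA mulfV ?gt_eqF // mulr1.
Qed.

(** The last clause uses commutation: the increment of [Tstar T t y] along [T s] at [u] is that of
    [y] at [T t u]. *)
Lemma dominated_Tstar t y : 0 <= t -> linear_form y -> dominated y (Tstar T t y).
Proof.
move=> t0 yl; split.
- by move=> a u v; rewrite /Tstar T_linear // yl.
- move=> C C0 yC u; apply: le_trans (yC _) _.
  by rewrite [M * C]mulrC -mulrA ler_wpM2l // T_bound.
- move=> s s0 b b0 yb u; rewrite /Tstar T_comm //; apply: le_trans (yb _) _.
  by rewrite [M * b]mulrC -mulrA ler_wpM2l // T_bound.
Qed.

Lemma dominated_average n (w : 'I_n -> K) (z : 'I_n -> fX) y :
  (forall i, `|w i| <= n%:R^-1) -> (forall i, dominated y (z i)) ->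
  dominated y (fun u => \sum_i w i * z i u).
Proof.
move=> w1 zd.
have avg (f : 'I_n -> K) (B : K) : 0 <= B -> (forall i, `|f i| <= B) -> `|\sum_i w i * f i| <= B.
  move=> B0 fB; apply: le_trans (ler_norm_sum _ _ _) _.
  apply: le_trans (_ : \sum_(i < n) n%:R^-1 * B <= B).
    by apply: ler_sum => i _; rewrite normrM ler_pM.
  rewrite sumr_const card_ord -[leLHS]mulr_natl mulrA.
  by case: n {w z w1 zd f fB} => [|n]; rewrite ?mul0r // mulfV ?mul1r // pnatr_eq0.
split.
- move=> a u v; rewrite mulr_sumr -big_split /=; apply: eq_bigr => i _.
  by have [-> _ _] := zd i; rewrite mulrDr mulrCA.
- move=> C C0 yC u; apply: avg; first by rewrite !mulr_ge0 // ltW.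
  by move=> i; have [_ + _] := zd i; apply.
- move=> t t0 b b0 yb u; rewrite -sumrB.
  under eq_bigr => i _ do rewrite -mulrBr.
  apply: avg; first by rewrite !mulr_ge0 // ltW.
  by move=> i; have [_ _ +] := zd i; apply.
Qed.

(** Every clause is an equation or a non-strict bound on values at fixed points, hence closed under
    pointwise limits. *)
Lemma dominated_ulim I (F : set_system I) {FF : ProperFilter F} (z : I -> fX) y z' :
  F [set i | dominated y (z i)] -> (forall u, ucvg F (fun i => z i u) (z' u)) -> dominated y z'.
Proof.
move=> Fz zz'; split.
- move=> a u v; apply: ucvg_unique (zz' _) _ => e e0.
  apply: filterS2 Fz (ucvgD (ucvgM (ucvg_cst a) (zz' u)) (zz' v) e0) => i [zl _ _].
  by rewrite /= zl.
- move=> C C0 yC u; apply: ucvg_norm_le (zz' u) _.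
  by apply: filterS Fz => i [_ + _]; apply.
- move=> t t0 b b0 yb u; apply: ucvg_norm_le (ucvgB (zz' (T t u)) (zz' u)) _.
  by apply: filterS Fz => i [_ _ +]; apply.
Qed.

Lemma sun_Tstar t y : 0 <= t -> sun T y -> sun T (Tstar T t y).
Proof. by move=> t0 ys; apply: dominated_sun (dominated_Tstar t0 (sun_linear ys)). Qed.

Lemma sun_comb (a : K) y z : sun T y -> sun T z -> sun T (fun u => a * y u + z u).
Proof.
move=> [yd ys] [zd zs]; have [yl _] := yd; have [zl _] := zd; split.
  have [C C0 yC] := dualel_bound yd; have [D D0 zD] := dualel_bound zd.
  apply: (@bounded_dualel _ (`|a| * C + D)) => [b u v|u].
    by rewrite yl zl; ring.
  rewrite mulrDl (le_trans (ler_normD _ _)) // lerD // normrM -mulrA ler_wpM2l //.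
move=> e e0; have a1 : 0 < `|a| + 1 by rewrite ltr_wpDl.
have e20 : 0 < e / 2 by rewrite divr_gt0.
have [d1 [d10 d1P]] := ys (e / 2 / (`|a| + 1)) (divr_gt0 e20 a1).
have [d2 [d20 d2P]] := zs (e / 2) e20.
exists (Num.min d1 d2); split; first by rewrite lt_min d10.
move=> t; rewrite lt_min => /and3P[t0 td1 td2] u; rewrite /Tstar.
have -> : a * y (T t u) + z (T t u) - (a * y u + z u) =
  a * (y (T t u) - y u) + (z (T t u) - z u) by ring.
apply: le_trans (ler_normD _ _) _; rewrite [in leRHS](splitr e) mulrDl lerD //; last first.
  by apply: d2P; rewrite t0.
rewrite normrM; have := d1P t _ u; rewrite /Tstar t0 td1 => /(_ isT) h.
apply: le_trans (_ : (`|a| + 1) * `|y (T t u) - y u| <= _).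
  by rewrite ler_wpM2r // lerDl.
by rewrite mulrC -ler_pdivlMr // mulrAC.
Qed.

Lemma dominated_ddist y z c : dominated y z -> ddist_le y (fun=> 0) c -> ddist_le z (fun=> 0) (M * c).
Proof.
move=> [zl zb _] yc u; have [->|u0] := eqVneq u 0.
  by rewrite linear_form0 // normr0 subrr normr0 mulr0.
have c0 : 0 <= c.
  by rewrite -(pmulr_lge0 _ (_ : 0 < `|u|)) ?normr_gt0 // (le_trans _ (yc u)).
rewrite subr0 zb // => v; by have := yc v; rewrite subr0.
Qed.

Lemma Tcl_approx U y u (e : K) : Tcl T U -> sun T y -> 0 < e ->
  exists2 t, 0 <= t & `|U y u - y (T t u)| < e.
Proof.
move=> [_ Ua] ys e0.
have [t [t0 tP]] := Ua 1%N (fun=> u) (fun=> y) e (fun=> ys) e0.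
by exists t => //; apply: (tP ord0).
Qed.

Lemma Tcl_sun U y : Tcl T U -> sun T y -> sun T (U y).
Proof. by case=> -[+ _ _] _; apply. Qed.

Lemma Tcl_dominated U y : Tcl T U -> sun T y -> dominated y (U y).
Proof.
move=> TU ys; split; first exact/sun_linear/Tcl_sun.
- move=> C C0 yC u; apply/ler_addgt0Pr => e e0.
  have [t t0 tP] := Tcl_approx u TU ys e0.
  rewrite -[U y u](subrK (y (T t u))) addrC (le_trans (ler_normD _ _)) // lerD ?(ltW tP) //.
  by have [_ + _] := dominated_Tstar t0 (sun_linear ys); apply.
- move=> t t0 b b0 yb u; apply/ler_addgt0Pr => e e0.
  (* A single time [s] serves at both [T t u] and [u], so that the increment of [U y] is compared
     with that of one [Tstar T s y]. *)
  have [s [s0 sP]] : exists s, 0 <= s /\ forall i : 'I_2,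
      `|U y (if i == ord0 then T t u else u) - y (T s (if i == ord0 then T t u else u))| < e / 2.
    by have [_ Ua] := TU; apply: (Ua 2%N _ (fun=> y)) => //; rewrite divr_gt0.
  have /= h0 := sP ord0; have /= h1 := sP (lift ord0 ord0).
  have -> : U y (T t u) - U y u = (y (T s (T t u)) - y (T s u)) +
     ((U y (T t u) - y (T s (T t u))) - (U y u - y (T s u))) by ring.
  apply: le_trans (ler_normD _ _) _; apply: lerD.
    by have [_ _ +] := dominated_Tstar s0 (sun_linear ys); apply.
  by rewrite (splitr e) (le_trans (ler_normB _ _)) // lerD // ltW.
Qed.

Lemma Tcl_Tstar t : 0 <= t -> Tcl T (Tstar T t).
Proof.
move=> t0; split; last first.
  move=> n xs ys e _ e0; exists t; split=> // i; by rewrite subrr normr0.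
split.
- by move=> y; apply: sun_Tstar.
- by [].
- exists M => y ys c; exact/dominated_ddist/dominated_Tstar/sun_linear.
Qed.

Lemma Tcl_comp U V : Tcl T U -> Tcl T V -> Tcl T (U \o V).
Proof.
move=> TU TV; have [[Us Ul [MU UM]] Ua] := TU; have [[Vs Vl [MV VM]] Va] := TV; split.
  split=> /=.
  - by move=> y /Vs/Us.
  - by move=> a y z ys zs; rewrite Vl // Ul //; exact: Vs.
  - exists (MU * MV) => y ys c yc; rewrite -mulrA; apply: UM; first exact: Vs.
    exact: VM.
move=> n xs ys e yss e0; have e20 : 0 < e / 2 by rewrite divr_gt0.
(* [t] is fixed first, at the functionals [V (ys i)]; then [V] is approximated at the points
   [T t (xs i)], which depend on [t]. *)
have [t [t0 tP]] := Ua n xs (V \o ys) (e / 2) (fun i => Vs _ (yss i)) e20.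
have [s [s0 sP]] := Va n (T t \o xs) ys (e / 2) yss e20.
exists (s + t); split; first exact: addr_ge0.
move=> i; rewrite /= /Tstar T_add // (splitr e).
have := ltrD (tP i) (sP i); rewrite /= /Tstar; apply: le_lt_trans.
by apply: le_trans (ler_normD _ _); rewrite addrA subrK.
Qed.

(** This is the compactness of the closure: [Tcl_dominated] bounds the values uniformly, so
    pointwise limits exist, and they inherit linearity, boundedness and approximability. *)
Lemma Tcl_ulim I (F : set_system I) (V : I -> fX -> fX) : UltraFilter F ->
  F [set i | Tcl T (V i)] ->
  exists2 U, Tcl T U & forall y, sun T y -> forall u, ucvg F (fun i => V i y u) (U y u).
Proof.
move=> FU FV.
(* The default 0 can occur only for [y] outside the sun dual. *)
pose U y u : K := xget 0 [set l | ucvg F (fun i => V i y u) l].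
have Ucvg y : sun T y -> forall u, ucvg F (fun i => V i y u) (U y u).
  move=> ys u; rewrite /U; apply: xgetPex.
  have [yd _] := ys; have [C C0 yC] := dualel_bound yd.
  apply: (@ultra_ucvg _ _ _ _ (M * C * `|u|)).
  apply: filterS FV => i /= Vi; have [_ + _] := Tcl_dominated Vi ys.
  by apply=> //; apply: ltW.
have Udom y : sun T y -> dominated y (U y).
  move=> ys; apply: dominated_ulim (Ucvg _ ys).
  by apply: filterS FV => i /= Vi; apply: Tcl_dominated.
exists U => //; split.
  split=> [y ys|a y z ys zs|]; first exact: dominated_sun (Udom y ys).
    apply/funext => u; apply: ucvg_unique (Ucvg _ (sun_comb a ys zs) u) _ => e e0.
    apply: filterS2 FV (ucvgD (ucvgM (ucvg_cst a) (Ucvg _ ys u)) (Ucvg _ zs u) e0).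
    by move=> i [[_ Vl _] _] /=; rewrite Vl.
  by exists M => y ys c; apply: dominated_ddist; apply: Udom.
move=> n xs ys e yss e0; have e20 : 0 < e / 2 by rewrite divr_gt0.
have Fall : F [set i | forall k, `|V i (ys k) (xs k) - U (ys k) (xs k)| < e / 2].
  by apply: filter_forall => k; apply: Ucvg.
have [i /= [[_ Va] iP]] := filter_ex (filterI FV Fall).
have [t [t0 tP]] := Va n xs ys (e / 2) yss e20.
exists t; split=> // k; rewrite (splitr e).
have := iP k; rewrite distrC => h; apply: le_lt_trans (ltrD h (tP k)).
by apply: le_trans (ler_normD _ _); rewrite addrA subrK.
Qed.

End Semigroup.

(** * Inverses in the kernel of the closure *)

Section Kernel.
Variables (R : realType) (X : completeNormedModType R[i]) (T : R -> X -> X).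
Local Notation K := R[i].
Local Notation fX := (X -> K).
Variable M : K.
Hypothesis M_gt0 : 0 < M.
Hypothesis T_linear : forall t : R, 0 <= t -> forall (a : K) u v, T t (a *: u + v) = a *: T t u + T t v.
Hypothesis T_add : forall s t : R, 0 <= s -> 0 <= t -> forall u, T (s + t) u = T s (T t u).
Hypothesis T_bound : forall t : R, 0 <= t -> forall u, `|T t u| <= M * `|u|.
Hypothesis Tabel : Tcl_abelian T.

(** Closedness is phrased through ultrafilter limits tested on the sun dual only, so that membership
    ignores the values of an operator elsewhere. *)
Definition w_closed_ideal (I : set (fX -> fX)) := [/\ I `<=` Tcl T, I !=set0,
  (forall U V, I U -> Tcl T V -> I (U \o V)) &
  (forall (J : Type) (F : set_system J) (V : J -> fX -> fX) W, UltraFilter F ->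
    F [set j | I (V j)] -> Tcl T W ->
    (forall y, sun T y -> forall u, ucvg F (fun j => V j y u) (W y u)) -> I W)].

Lemma w_closed_ideal_ext I U V : w_closed_ideal I -> I U -> Tcl T V ->
  (forall y, sun T y -> V y = U y) -> I V.
Proof.
move=> [_ _ _ Icl] IU TV VU.
apply: (Icl unit (principal_filter tt) (fun=> U)) => //.
- exact: principal_filter_ultra.
- by move=> y ys u e e0; apply/principal_filterP; rewrite /= VU // subrr normr0.
Qed.

Definition ideal_mul (B : fX -> fX) (I : set (fX -> fX)) : set (fX -> fX) :=
  [set W | Tcl T W /\ exists2 V, I V & forall y, sun T y -> W y = B (V y)].

Lemma w_closed_ideal_mul B I : Tcl T B -> w_closed_ideal I -> w_closed_ideal (ideal_mul B I).
Proof.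
move=> TB [IT [U0 IU0] Iid Icl]; split.
- by move=> W [].
- by exists (B \o U0); split; [exact: Tcl_comp (IT _ IU0) | exists U0].
- move=> W V' [TW [V IV WE]] TV'; split; first exact: Tcl_comp.
  exists (V \o V'); first exact: Iid.
  by move=> y ys /=; rewrite WE //; apply: Tcl_sun TV' _.
- move=> J F W W' FU FW TW' WW'; split=> //.
  have /choice[v vP] : forall j, exists V, ideal_mul B I (W j) ->
      I V /\ forall y, sun T y -> W j y = B (V y).
    move=> j; have [[_ [V IV WE]]|nW] := pselect (ideal_mul B I (W j)); last by exists U0.
    by exists V.
  have Fv : F [set j | Tcl T (v j)].
    by apply: filterS FW => j /= /vP[Iv _]; apply: IT.
  have [V TV vV] := Tcl_ulim M_gt0 T_linear T_add T_bound FU Fv.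
  exists V.
    by apply: (Icl _ F v) => //; apply: filterS FW => j /= /vP[].
  move=> y ys; apply/funext => u.
  (* [B] may fail to be w*-continuous, so commutativity moves it to the argument:
     [B (v j y) = v j (B y)] tends to [V (B y) = B (V y)]. *)
  apply: ucvg_unique (WW' y ys u) _; rewrite (Tabel TB TV ys) => e e0.
  apply: filterS2 FW (vV _ (Tcl_sun TB ys) u e e0) => j /= Wj.
  have [Iv WE] := vP _ Wj.
  by rewrite WE // (Tabel TB (IT _ Iv) ys).
Qed.

Lemma ideal_mul_sub B I : Tcl T B -> w_closed_ideal I -> ideal_mul B I `<=` I.
Proof.
move=> TB Iid W [TW [V IV WE]]; have [IT _ Imul _] := Iid.
apply: w_closed_ideal_ext (Imul _ _ IV TB) TW _ => //= y ys.
by rewrite WE // (Tabel TB (IT _ IV) ys).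
Qed.

Lemma Tcl_w_closed_ideal : w_closed_ideal (Tcl T).
Proof.
split=> //.
- exists (Tstar T 0); exact: (Tcl_Tstar M_gt0 T_linear T_add T_bound).
- by move=> U V; apply: Tcl_comp.
Qed.

(** Zorn's lemma for reverse inclusion. The intersection of a nonempty chain is nonempty: an
    ultrafilter containing all its members has a limit operator, which lies in each of them. *)
Lemma minimal_w_closed_ideal I : w_closed_ideal I -> exists I0, [/\ w_closed_ideal I0, I0 `<=` I &
  forall I1, w_closed_ideal I1 -> I1 `<=` I0 -> I0 `<=` I1].
Proof.
move=> Iid; pose Q := {J | w_closed_ideal J /\ J `<=` I}.
pose Ile (s t : Q) := `[< sval t `<=` sval s >].
have [||A Atot|t tP] := @ZL_preorder Q (exist _ I (conj Iid (fun _ h => h))) Ile.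
- by move=> t; apply/asboolP.
- by move=> r s t /asboolP sr /asboolP ts; apply/asboolP => x /ts/sr.
- have [[s0 As0]|nA] := pselect (exists s, A s); last first.
    by exists (exist _ I (conj Iid (fun _ h => h))) => s As; case: nA; exists s.
  have minA n (l : 'I_n -> {s : Q | A s}) : exists2 s, A s &
      forall i, sval s `<=` sval (sval (l i)).
    elim: n l => [|n IH] l; first by exists s0 => // -[].
    have [s' As' s'P] := IH (l \o lift ord0); have As := svalP (l ord0).
    have [/asboolP ss'|/asboolP s's] := Atot _ _ As As'.
      by exists s' => // i; case: (unliftP ord0 i) => [j ->|->] //; exact: s'P.
    exists (sval (l ord0)) => // i; case: (unliftP ord0 i) => [j ->|->] //.
    exact: subset_trans s's (s'P j).
  have [|F [FU FA]] := @ultrafilter_of_fip {s : Q | A s} _ (fun s => sval (sval s)).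
    move=> n l; have [s As sP] := minA n l.
    have [[_ [U sU] _ _] _] := svalP s.
    by exists U => i; apply: sP.
  have FT : F [set V | Tcl T V].
    have [[sT _ _ _] _] := svalP s0.
    by apply: filterS (FA (exist _ s0 As0)).
  have [U TU FUcvg] := @Tcl_ulim _ _ _ _ M_gt0 T_linear T_add T_bound _ F id FU FT.
  have AU s : A s -> sval s U.
    move=> As; have [[_ _ _ sC] _] := svalP s.
    by apply: (sC _ F id) => //; apply: (FA (exist _ s As)).
  pose J : set (fX -> fX) := [set V | forall s, A s -> sval s V].
  have Jid : w_closed_ideal J /\ J `<=` I.
    split; last by move=> V /(_ _ As0); case: (svalP s0) => _; apply.
    split.
    - by move=> V /(_ _ As0); case: (svalP s0) => -[sT _ _ _] _; apply: sT.
    - by exists U.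
    - by move=> V W JV TW s As; have [[_ _ sm _] _] := svalP s; apply: sm (JV _ As) TW.
    - move=> J' G V W GU GJ TW VW s As; have [[_ _ _ sC] _] := svalP s.
      by apply: (sC _ G V) => //; apply: filterS GJ => j /= /(_ _ As).
  exists (exist _ J Jid) => s As; apply/asboolP => V /=; exact.
exists (sval t); have [tid tI] := svalP t; split=> // I1 I1id I1t.
have I1I : w_closed_ideal I1 /\ I1 `<=` I by split=> //; exact: subset_trans tI.
have tI1 : Ile t (exist _ I1 I1I) by apply/asboolP.
by have /asboolP := tP _ tI1.
Qed.

(** Minimality gives [a I0 = I0] for [a] in [I0]. With [a = a e] and then [e = a b] inside [I0],
    commutativity yields [e e = e a b = a e b = a b = e]. *)
Lemma idempotent_in_w_closed_ideal I : w_closed_ideal I -> exists2 Q, I Q & Tcl_idempotent T Q.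
Proof.
move=> /minimal_w_closed_ideal[I0 [I0id I0I I0min]].
have [I0T [a I0a] I0mul _] := I0id.
have Ta := I0T _ I0a.
have aI0 : I0 `<=` ideal_mul a I0.
  by apply: I0min; [exact: w_closed_ideal_mul | exact: ideal_mul_sub].
have [_ [e I0e ae]] := aI0 _ I0a.
have [_ [b I0b eb]] := aI0 _ I0e.
have Te := I0T _ I0e; have Tb := I0T _ I0b.
exists e; first exact: I0I.
split=> // y ys.
have bs := Tcl_sun Tb ys.
by rewrite (eb y ys) (Tabel Te Ta bs) -(ae _ bs).
Qed.

(** The closed ideal generated by [P U] contains an idempotent [Q = P U V]. As [P Q = Q], minimality
    gives [Q P = P], which reads [V U P = P] after commuting. *)
Lemma minimal_idempotent_inverse P U : Tcl_minimal_idempotent T P -> Tcl T U ->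
  exists2 V, Tcl T V & forall y, sun T y -> V (U (P y)) = P y.
Proof.
move=> [[TP PP] Pmin] TU.
have TPU := Tcl_comp T_add TP TU.
have [Q [TQ [V TV QE]] [_ QQ]] :=
  idempotent_in_w_closed_ideal (w_closed_ideal_mul TPU Tcl_w_closed_ideal).
exists V => // y ys.
have PQ z : sun T z -> P (Q z) = Q z.
  by move=> zs; rewrite QE //= PP //; exact: Tcl_sun TU (Tcl_sun TV zs).
have Ps := Tcl_sun TP ys.
rewrite -[RHS](Pmin Q _ PQ) // QE //= (Tabel TP (Tcl_comp T_add TU TV)) //= PP //.
by rewrite (Tabel TU TV Ps).
Qed.
End Kernel.

(** * Total boundedness of orbits *)

Section Compactness.
Variables (R : realType) (X : completeNormedModType R[i]) (T : R -> X -> X).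
Local Notation K := R[i].
Local Notation fX := (X -> K).

Lemma ddist_le_refl (y : fX) : ddist_le y y 0.
Proof. by move=> u; rewrite subrr normr0 mul0r. Qed.

Lemma ddist_le_sym (y z : fX) e : ddist_le y z e -> ddist_le z y e.
Proof. by move=> yz u; rewrite distrC. Qed.

Lemma ddist_le_trans (y z w : fX) d e : ddist_le y z d -> ddist_le z w e -> ddist_le y w (d + e).
Proof.
by move=> yz zw u; rewrite mulrDl (le_trans (ler_distD (z u) _ _)) // lerD.
Qed.

Lemma ddist_le_weak (y z : fX) d e : d <= e -> ddist_le y z d -> ddist_le y z e.
Proof. by move=> de yz u; rewrite (le_trans (yz u)) // ler_wpM2r. Qed.

Variable M : K.
Hypothesis M_gt0 : 0 < M.
Hypothesis T_linear : forall t : R, 0 <= t -> forall (a : K) u v, T t (a *: u + v) = a *: T t u + T t v.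
Hypothesis T_zero : forall u, T 0 u = u.
Hypothesis T_add : forall s t : R, 0 <= s -> 0 <= t -> forall u, T (s + t) u = T s (T t u).
Hypothesis T_bound : forall t : R, 0 <= t -> forall u, `|T t u| <= M * `|u|.

Variable x : fX.
Hypothesis xs : sun T x.
Local Notation orb t := (Tstar T t x).

Definition totally_bounded_orbit := forall e : K, 0 < e ->
  exists n (c : 'I_n -> R), (forall i, 0 <= c i) /\
    forall t, 0 <= t -> exists i, ddist_le (orb t) (orb (c i)) e.

Definition ultra_cauchy_orbit := forall F : set_system R, UltraFilter F -> F [set t | 0 <= t] ->
  forall e : K, 0 < e -> exists2 s, 0 <= s & F [set t | ddist_le (orb t) (orb s) e].

(** Without a finite [e]-net, the sets of times whose orbit points are far from a given one have the
    finite intersection property, and an ultrafilter containing them all is not Cauchy at scale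
    [e]. *)
Lemma ultra_cauchy_totally_bounded : ultra_cauchy_orbit -> totally_bounded_orbit.
Proof.
move=> ux e e0; apply: contrapT => ncov.
have [|F [FU FA]] := @ultrafilter_of_fip R R
    (fun s => [set t | 0 <= t /\ (0 <= s -> ~ ddist_le (orb t) (orb s) e)]).
  move=> n s; apply: contrapT => nt; apply: ncov.
  (* A negative [s i] imposes no condition and is replaced by the time 0. *)
  exists n, (fun i => Num.max 0 (s i)); split=> [i|t t0]; first by rewrite le_max lexx.
  apply: contrapT => /forallNP far; apply: nt; exists t => i; split=> // si0.
  by have := far i; rewrite max_r.
have F0 : F [set t | 0 <= t] by apply: filterS (FA 0) => t [].
have [s s0 Fs] := ux F FU F0 e e0.
have [t [/= [_ /(_ s0)]]] := filter_ex (filterI (FA s) Fs).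
by [].
Qed.

Lemma orbit_subset_wcl t : 0 <= t -> wcl T (sg_orbit T x) (orb t).
Proof.
move=> t0; split; first exact: (sun_Tstar M_gt0 T_linear T_add T_bound).
move=> n us e e0; exists (orb t); first by exists t.
by move=> i; rewrite subrr normr0.
Qed.

Lemma Tcl_wcl U : Tcl T U -> wcl T (sg_orbit T x) (U x).
Proof.
move=> TU; split; first exact: Tcl_sun.
move=> n us e e0; have [_ Ua] := TU.
have [t [t0 tP]] := Ua n us (fun=> x) e (fun=> xs) e0.
by exists (orb t) => //; exists t.
Qed.

Lemma wcl_ultra z : wcl T (sg_orbit T x) z ->
  exists F : set_system R, [/\ UltraFilter F, F [set t | 0 <= t] &
    forall u, ucvg F (fun t => x (T t u)) (z u)].
Proof.
move=> [_ zcl].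
have [|F [FU FA]] := @ultrafilter_of_fip (X * nat) R
    (fun p => [set t | 0 <= t /\ `|x (T t p.1) - z p.1| < p.2.+1%:R^-1]).
  (* The largest index gives the smallest tolerance, which serves all the conditions. *)
  move=> n s; pose m := \max_i (s i).2.
  have [|_ [t [t0 ->]] tP] := zcl n (fun i => (s i).1) m.+1%:R^-1; first by rewrite invr_gt0.
  exists t => i; split=> //; rewrite distrC (lt_le_trans (tP i)) //.
  by rewrite lef_pV2 ?posrE // ler_nat ltnS (leq_bigmax i).
exists F; split=> //; first by apply: filterS (FA (0, 0%N)) => t [].
move=> u e /invn_lt[n ne]; apply: filterS (FA (u, n)) => t [_] /= h.
exact: lt_trans h ne.
Qed.

Lemma Tcl_ultra U : Tcl T U -> exists F : set_system R, [/\ UltraFilter F, F [set t | 0 <= t] &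
    forall y, sun T y -> forall u, ucvg F (fun t => y (T t u)) (U y u)].
Proof.
move=> [_ Ua].
have [|F [FU FA]] := @ultrafilter_of_fip ({y | sun T y} * X * nat) R
    (fun p => [set t | 0 <= t /\
      `|sval p.1.1 (T t p.1.2) - U (sval p.1.1) p.1.2| < p.2.+1%:R^-1]).
  move=> n s; pose m := \max_i (s i).2.
  have [||t [t0 tP]] := Ua n (fun i => (s i).1.2) (fun i => sval (s i).1.1) m.+1%:R^-1.
  - by move=> i; apply: svalP.
  - by rewrite invr_gt0.
  exists t => i; split=> //; rewrite distrC (lt_le_trans (tP i)) //.
  by rewrite lef_pV2 ?posrE // ler_nat ltnS (leq_bigmax i).
exists F; split=> //; first by apply: filterS (FA (exist _ x xs, 0, 0%N)) => t [].
move=> y ys u e /invn_lt[n ne]; apply: filterS (FA (exist _ y ys, u, n)) => t [_] /= h.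
exact: lt_trans h ne.
Qed.

Lemma Tcl_of_ultra (F : set_system R) : UltraFilter F -> F [set t | 0 <= t] ->
  exists2 U, Tcl T U & forall y, sun T y -> forall u, ucvg F (fun t => y (T t u)) (U y u).
Proof.
move=> FU F0; apply: (Tcl_ulim M_gt0 T_linear T_add T_bound (V := Tstar T) FU).
by apply: filterS F0 => t; apply: (Tcl_Tstar M_gt0 T_linear T_add T_bound).
Qed.

(** An ultrafilter of times that converges to [z] on the orbit of [x] converges on the whole sun
    dual by compactness, and its limit operator takes [x] to [z]. *)
Lemma wcl_Tcl z : wcl T (sg_orbit T x) z -> exists2 U, Tcl T U & z = U x.
Proof.
move=> /wcl_ultra[F [FU F0 Fz]].
have [U TU UP] := Tcl_of_ultra FU F0.
by exists U => //; apply/funext => u; apply: ucvg_unique (Fz u) (UP x xs u).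
Qed.

Lemma wcl_dominated z : wcl T (sg_orbit T x) z -> dominated T M x z.
Proof. by move=> /wcl_Tcl[U TU ->]; apply: Tcl_dominated. Qed.

(** Norm balls are closed under pointwise limits, so a finite net of the orbit is also a net of its
    w*-closure; the nets at the scales [n.+1%:R^-1] together form the dense sequence. *)
Lemma totally_bounded_separable : totally_bounded_orbit -> norm_separable (wcl T (sg_orbit T x)).
Proof.
move=> tb.
have /choice[net netP] : forall n : nat, exists l : seq R, all (fun s => 0 <= s) l /\
    forall z, wcl T (sg_orbit T x) z -> exists2 s, s \in l & ddist_le z (orb s) n.+1%:R^-1.
  move=> n; have [|m [c [c0 cP]]] := tb n.+1%:R^-1; first by rewrite invr_gt0.
  exists [seq c i | i <- enum 'I_m]; split.
    by apply/allP => _ /mapP[i _ ->].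
  move=> z /wcl_ultra[F [FU F0 Fz]].
  have [|i Fi] := @ultra_finite_union _ F m
      (fun i => [set t | ddist_le (orb t) (orb (c i)) n.+1%:R^-1]) FU.
    by apply: filterS F0 => t /= /cP.
  exists (c i); first by apply: map_f; rewrite mem_enum.
  move=> u; apply: ucvg_norm_le (ucvgB (Fz u) (ucvg_cst (orb (c i) u))) _.
  by apply: filterS Fi => t; apply.
pose d k := let p := odflt (0%N, 0%N) (unpickle k) in orb (nth 0 (net p.1) p.2).
exists d; split.
  move=> k; apply: orbit_subset_wcl; case: (odflt _ _) => n i /=.
  have [lt|ge] := ltnP i (size (net n)); last by rewrite nth_default.
  by have [/allP + _] := netP n; apply; apply: mem_nth.
move=> z zcl e /invn_lt[n ne].
have [_ /(_ z zcl)[s sl zs]] := netP n.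
exists (pickle (n, index s (net n))); rewrite /d pickleK /= nth_index //.
exact: ddist_le_weak (ltW ne) zs.
Qed.

Lemma ncl_subset_wcl z : ncl T (sg_orbit T x) z -> wcl T (sg_orbit T x) z.
Proof.
move=> [zs zn]; split=> // n us e e0.
pose B := 1 + \sum_i `|us i|.
have B0 : 0 < B by rewrite ltr_pwDl // sumr_ge0.
have [s sO sP] := zn (e / B) (divr_gt0 e0 B0).
exists s => // i; apply: le_lt_trans (sP _) _.
rewrite mulrAC ltr_pdivrMr // ltr_pM2l // /B (bigD1 i) //=.
by rewrite addrCA ltr_pwDr // ltr_pwDl // sumr_ge0.
Qed.

(** Without a finite subcover, an ultrafilter on the norm closure avoids every member of the cover.
    Total boundedness makes it norm Cauchy, so its pointwise limit [w] is a norm limit in the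
    closure, and the member of the cover around [w] gives a contradiction. *)
Lemma totally_bounded_rel_ncompact : totally_bounded_orbit -> rel_ncompact T (sg_orbit T x).
Proof.
move=> tb; split; first by move=> z [].
set A := ncl T (sg_orbit T x).
have xA : A x.
  split=> // e e0; exists x; last exact: ddist_le_weak (ltW e0) (ddist_le_refl _).
  by exists 0; split=> //; apply/funext => u; rewrite /Tstar T_zero.
move=> C Copen AC; apply: contrapT => nfin.
have [|F [FU FA]] := @ultrafilter_of_fip {G | C G} fX (fun G => A `\` sval G).
  move=> n G; apply: contrapT => nz; apply: nfin.
  exists n, (fun i => sval (G i)); split=> [i|z Az]; first exact: svalP.
  apply: contrapT => nGz; apply: nz; exists z => i; split=> // Giz.
  by apply: nGz; exists i.
have FAA : F A.
  have [G CG _] := AC x xA.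
  by apply: filterS (FA (exist _ G CG)) => z [].
have Cauchy e : 0 < e -> exists2 s, 0 <= s & F [set z | ddist_le z (orb s) e].
  move=> e0; have e20 : 0 < e / 2 by rewrite divr_gt0.
  have [n [c [c0 cP]]] := tb _ e20.
  have [|i Fi] := @ultra_finite_union _ F n (fun i => [set z | ddist_le z (orb (c i)) e]) FU.
    apply: filterS FAA => z [_ /(_ _ e20)[_ [t [t0 ->]] zt]].
    have [i ti] := cP t t0; exists i; rewrite (splitr e).
    exact: ddist_le_trans zt ti.
  by exists (c i).
have /choice[w wP] : forall u, exists l, ucvg F (fun z => z u) l.
  move=> u; have [s s0 Fs] := Cauchy 1 ltr01.
  apply: (@ultra_ucvg _ _ _ _ (1 * `|u| + `|orb s u|)).
  apply: filterS Fs => z /= zs.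
  by rewrite -[z u](subrK (orb s u)) (le_trans (ler_normD _ _)) // lerD2r.
have wdist s e : F [set z | ddist_le z (orb s) e] -> ddist_le w (orb s) e.
  move=> Fs u; apply: ucvg_norm_le (ucvgB (wP u) (ucvg_cst (orb s u))) _.
  by apply: filterS Fs => z; apply.
have wsun : sun T w.
  apply: (dominated_sun M_gt0 xs); apply: dominated_ulim wP.
  by apply: filterS FAA => z /ncl_subset_wcl/wcl_dominated.
have Aw : A w.
  split=> // e /Cauchy[s s0 Fs].
  by exists (orb s); [exists s | exact: wdist].
have [G CG Gw] := AC w Aw.
have [e e0 eG] := Copen G CG w Gw.
have e20 : 0 < e / 2 by rewrite divr_gt0.
have [s s0 Fs] := Cauchy _ e20.
have [z [[[zs _] nGz] zS]] := filter_ex (filterI (FA (exist _ G CG)) Fs).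
apply: nGz; apply: eG => //; rewrite (splitr e).
exact: ddist_le_trans zS (ddist_le_sym (wdist _ _ Fs)).
Qed.

Lemma rel_ncompact_totally_bounded : rel_ncompact T (sg_orbit T x) -> totally_bounded_orbit.
Proof.
move=> [_ cpt] e e0.
have e20 : 0 < e / 2 by rewrite divr_gt0.
set A := ncl T (sg_orbit T x) in cpt *.
(* A radius strictly below [e / 2] makes the ball open, [ddist_le] being a non-strict bound. *)
pose ball g : set fX := [set h | exists2 r, r < e / 2 & ddist_le h g r].
have [|z Az|n [G [GC Gcov]]] := cpt [set ball g | g in A].
- move=> _ [g Ag <-] h [r re hr].
  exists ((e / 2 - r) / 2); first by rewrite divr_gt0 // subr_gt0.
  move=> k ks kh; exists ((e / 2 - r) / 2 + r); last exact: ddist_le_trans kh hr.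
  rewrite -ltrBrDr ltr_pdivrMr // mulr_natr mulr2n ltrDl subr_gt0 //.
- by exists (ball z); [exists z | exists 0 => //; exact: ddist_le_refl].
have /choice[c cP] : forall i, exists s, 0 <= s /\ forall z, G i z -> ddist_le z (orb s) e.
  move=> i; have [g [_ /(_ _ e20)[_ [s [s0 ->]] gs]] <-] := GC i.
  exists s; split=> // z [r re zr]; rewrite (splitr e).
  exact: ddist_le_trans (ddist_le_weak (ltW re) zr) gs.
exists n, c; split=> [i|t t0]; first by case: (cP i).
have [|i _ Gi] := Gcov (orb t); last by exists i; case: (cP i) => _; apply.
split; first exact: (sun_Tstar M_gt0 T_linear T_add T_bound).
move=> d d0; exists (orb t); first by exists t.
exact: ddist_le_weak (ltW d0) (ddist_le_refl _).
Qed.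

(** On a finite combination of eigenvectors only the unimodular eigenvalues vary with time, and
    these converge along an ultrafilter. *)
Lemma sun_uds_ultra_cauchy : sun_uds T x -> ultra_cauchy_orbit.
Proof.
move=> [_ uds] F FU F0 e e0.
have e4 : 0 < e / 4 / M by rewrite !divr_gt0.
have [n [c [ys [yeig xc]]]] := uds _ e4.
have /choice[lam lamP] : forall i, exists lam : (fX -> fX) -> K,
    forall U, Tcl T U -> `|lam U| = 1 /\ U (ys i) = (fun u => lam U * ys i u).
  by move=> i; case: (yeig i).
have /choice[C CP] : forall i, exists C : K, 0 < C /\ forall u, `|ys i u| <= C * `|u|.
  by move=> i; have [[yd _] _] := yeig i; have [C C0 CP] := dualel_bound yd; exists C.
have TT := Tcl_Tstar M_gt0 T_linear T_add T_bound.
have /choice[L LP] : forall i, exists l, ucvg F (fun t => lam i (Tstar T t)) l.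
  move=> i; apply: (@ultra_ucvg _ _ _ _ 1).
  by apply: filterS F0 => t /= /TT /(lamP i)[->].
pose B := \sum_i `|c i| * C i.
have B0 : 0 <= B by rewrite sumr_ge0 // => i _; rewrite mulr_ge0 //; have [/ltW] := CP i.
(* The eigenvalue errors then cost at most [e / 2]; replacing [x] by the combination costs [e / 4]
   at each of the two times. *)
pose d := e / 4 / (B + 1).
have d0 : 0 < d by rewrite !divr_gt0 // ltr_wpDl.
have Fd : F [set t | 0 <= t /\ forall i, `|lam i (Tstar T t) - L i| < d].
  by apply: filterI => //; apply: filter_forall => i; apply: LP.
have [s [s0 sL]] := filter_ex Fd.
exists s => //; apply: filterS Fd => t [t0 tL] u.
pose p v := \sum_(i < n) c i * ys i v.
have pE r : 0 <= r -> p (T r u) = \sum_(i < n) lam i (Tstar T r) * (c i * ys i u).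
  move=> /TT Tr; apply: eq_bigr => i _; have [_ /(congr1 (@^~ u))] := lamP i _ Tr.
  by rewrite {1}/Tstar => ->; rewrite mulrCA.
have xp r : 0 <= r -> `|x (T r u) - p (T r u)| <= e / 4 * `|u|.
  move=> r0; apply: le_trans (xc _) _; rewrite mulrAC ler_pdivrMr //.
  rewrite -[leRHS]mulrA ler_pM2l ?divr_gt0 // [leRHS]mulrC; exact: T_bound.
have pp : `|p (T t u) - p (T s u)| <= e / 2 * `|u|.
  rewrite !pE // -sumrB; apply: le_trans (ler_norm_sum _ _ _) _.
  apply: le_trans (_ : \sum_i (d + d) * ((`|c i| * C i) * `|u|) <= _).
    apply: ler_sum => i _; rewrite -mulrBl normrM.
    apply: ler_pM => //.
      rewrite (le_trans (ler_distD (L i) _ _)) // lerD // ltW ?tL //.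
      by rewrite distrC sL.
    by rewrite normrM -mulrA ler_wpM2l //; case: (CP i).
  rewrite -mulr_sumr -mulr_suml mulrA ler_wpM2r //.
  apply: le_trans (_ : (d + d) * (B + 1) <= _).
    by rewrite ler_pM2l ?addr_gt0 // lerDl.
  by rewrite le_eqVlt /d; apply/orP; left; apply/eqP; field; rewrite gt_eqF // ltr_wpDl.
rewrite /Tstar.
have -> : x (T t u) - x (T s u) = (x (T t u) - p (T t u)) + (p (T t u) - p (T s u))
   - (x (T s u) - p (T s u)) by ring.
apply: le_trans (ler_normB _ _) _; apply: le_trans (lerD (ler_normD _ _) (xp s s0)) _.
apply: le_trans (lerD (lerD (xp t t0) pp) (lexx _)) _.
by rewrite le_eqVlt; apply/orP; left; apply/eqP; field.
Qed.

End Compactness.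

(** * Norm separable orbit closures *)

Section Separable.
Variables (R : realType) (X : completeNormedModType R[i]) (T : R -> X -> X).
Local Notation K := R[i].
Local Notation fX := (X -> K).
Variable M : K.
Hypothesis M_gt0 : 0 < M.
Hypothesis T_linear : forall t : R, 0 <= t -> forall (a : K) u v, T t (a *: u + v) = a *: T t u + T t v.
Hypothesis T_add : forall s t : R, 0 <= s -> 0 <= t -> forall u, T (s + t) u = T s (T t u).
Hypothesis T_bound : forall t : R, 0 <= t -> forall u, `|T t u| <= M * `|u|.

Lemma Tcl_ddist U y z e : Tcl T U -> sun T y -> sun T z -> ddist_le y z e ->
  ddist_le (U y) (U z) (M * e).
Proof.
move=> TU ys zs yz u.
have [[_ Ul _] _] := TU.
have ws := sun_comb (-1) zs ys.
have h : ddist_le (fun u => -1 * z u + y u) (fun=> 0) e.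
  by move=> v; rewrite subr0 mulN1r addrC.
have := dominated_ddist (Tcl_dominated T_linear T_add T_bound TU ws) h u.
by rewrite subr0 Ul // mulN1r addrC.
Qed.

Hypothesis Tabel : Tcl_abelian T.
Variables (P : fX -> fX) (x : fX).
Hypothesis Pmin : Tcl_minimal_idempotent T P.
Hypothesis xa : sun_a T P x.
Local Notation orb t := (Tstar T t x).
Local Notation S := (wcl T (sg_orbit T x)).

Let TT := Tcl_Tstar M_gt0 T_linear T_add T_bound.

Lemma sun_a_sun : sun T x.
Proof. by case: xa => y [ys ->]; case: Pmin => -[TP _] _; apply: Tcl_sun. Qed.
Let xs := sun_a_sun.

Lemma orbit_inverse U : Tcl T U -> exists2 V, Tcl T V &
  forall W, Tcl T W -> V (U (W x)) = W x.
Proof.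
move=> TU; have [V TV VP] := minimal_idempotent_inverse M_gt0 T_linear T_add T_bound Tabel Pmin TU.
exists V => // W TW; have [y [ys ->]] := xa; have [[TP _] _] := Pmin.
by rewrite (Tabel TW TP ys) VP //; apply: Tcl_sun TW ys.
Qed.

(** The element of the closure that inverts [Tstar T r] on the orbit expands distances by at most
    [M], so the bound is uniform in [r]. *)
Lemma orbit_bounded_below r t s e : 0 <= r -> 0 <= t -> 0 <= s ->
  ddist_le (Tstar T r (orb t)) (Tstar T r (orb s)) e -> ddist_le (orb t) (orb s) (M * e).
Proof.
move=> r0 t0 s0; have [V TV VP] := orbit_inverse (TT r0).
move=> /(Tcl_ddist TV (Tcl_sun (TT r0) (Tcl_sun (TT t0) xs)) (Tcl_sun (TT r0) (Tcl_sun (TT s0) xs))).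
by rewrite !VP //; exact: TT.
Qed.

(** Openness for pointwise convergence, in its ultrafilter form. *)
Definition w_open (N : set fX) := forall (I : Type) (F : set_system I) (V : I -> fX) w,
  UltraFilter F -> N w -> (forall u, ucvg F (fun i => V i u) (w u)) -> F [set i | N (V i)].

(* A Baire category argument in the compact space [S]: otherwise one could choose a decreasing sequence of
   nonempty open sets, the [k]-th of which stays away from the ball of radius [e] around [d k]. *)
Lemma small_w_open_set (e : K) : 0 < e -> norm_separable S ->
  exists N, [/\ w_open N, exists2 z, S z & N z &
    forall w w', S w -> S w' -> N w -> N w' -> ddist_le w w' (e + e)].
Proof.
move=> e0 [d [_ dS]]; apply: contrapT => nosmall.
pose q (N : set fX) := w_open N /\ exists2 z, S z & N z; pose Q := {N | q N}.
(* The bound by [g] is a closed condition, so it passes to limits, as membership in [N'] need not;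
   at the vector [u] it forces a distance above [e] from [d kN.1]. *)
have step : forall kN : nat * Q, exists N' : Q, sval N' `<=` sval kN.2 /\
    exists u a g, sval N' `<=` [set w | `|w u - a| <= g] /\ e * `|u| < `|a - d kN.1 u| - g.
  move=> [k [N [Nopen [z Sz Nz]]]] /=.
  have [w Sw [Nw ndw]] : exists2 w, S w & N w /\ ~ ddist_le w (d k) e.
    apply: contrapT => near; apply: nosmall; exists N; split=> //; first by exists z.
    have near' w : S w -> N w -> ddist_le w (d k) e.
      by move=> Sw Nw; apply: contrapT => ndw; apply: near; exists w.
    move=> w w' Sw Sw' Nw Nw'.
    exact: ddist_le_trans (near' w Sw Nw) (ddist_le_sym (near' w' Sw' Nw')).
  move/existsNP : ndw => [u /negP]; rewrite -real_ltNge ?normr_real //; last first.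
    by rewrite ger0_real // mulr_ge0 // ltW.
  rewrite -subr_gt0; set gap := _ - _ => gap0.
  have gap2 : 0 < gap / 2 by rewrite divr_gt0.
  have N'P : q [set v | N v /\ `|v u - w u| < gap / 2].
    split; last by exists w => //=; rewrite subrr normr0.
    move=> I F V v FU [Nv vu] Vv; apply: filterI; first exact: Nopen Nv Vv.
    have := Vv u _ (etrans (subr_gt0 _ _) vu); apply: filterS => i /=.
    rewrite ltrBrDr => h; apply: le_lt_trans h; exact: ler_distD.
  exists (exist q _ N'P) => /=; split; first by move=> v [].
  exists u, (w u), (gap / 2); split; first by move=> v [_ /ltW].
  have <- : gap / 2 + e * `|u| = `|w u - d k u| - gap / 2 by rewrite /gap; field.
  by rewrite ltrDr.
have /choice[f fP] := step.
have N0P : q setT.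
  split; first by move=> *; exact: filterT.
  by exists (orb 0) => //; apply: (orbit_subset_wcl M_gt0 T_linear T_add T_bound xs).
pose N := fix N k : Q := if k is j.+1 then f (j, N j) else exist q setT N0P.
have Ndecr j k : (j <= k)%N -> sval (N k) `<=` sval (N j).
  move=> /subnKC <-; elim: (k - j)%N => [|m IH]; rewrite ?addn0 // addnS.
  apply: subset_trans IH; by have [] := fP ((j + m)%N, N (j + m)%N).
have /choice[U UP] : forall k, exists U, Tcl T U /\ sval (N k) (U x).
  move=> k; have [_ [z Sz Nz]] := svalP (N k).
  have [U TU zU] := wcl_Tcl M_gt0 T_linear T_add T_bound xs Sz.
  by exists U; rewrite -zU.
(* The limit of the [U k x] along an ultrafilter finer than [eventually] meets all the closed
   conditions at once, so no [d k] is within [e] of it. *)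
have [F [FU Fev]] := ultraFilterLemma (@eventually_filter).
have FT : F [set k | Tcl T (U k)] by apply: filterE => k; case: (UP k).
have [V TV VP] := Tcl_ulim M_gt0 T_linear T_add T_bound FU FT.
have Vx := Tcl_wcl xs TV.
have [k dk] := dS _ Vx _ e0.
have [_ [u [a [g [Ng]]]]] := fP (k, N k).
move=> /= gap.
have Vg : `|V x u - a| <= g.
  apply: ucvg_norm_le (ucvgB (VP x xs u) (ucvg_cst a)) _.
  have : F [set j | (k.+1 <= j)%N] by apply: Fev; exists k.+1.
  apply: filterS => j kj; apply: (Ng _).
  by apply: (Ndecr k.+1 j kj); case: (UP j).
have /(lt_le_trans gap) : `|a - d k u| - g <= e * `|u|.
  by rewrite lerBlDr (le_trans (ler_distD (V x u) _ _)) // addrC lerD // distrC.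
by rewrite ltxx.
Qed.

Lemma separable_ultra_cauchy : norm_separable S -> ultra_cauchy_orbit T x.
Proof.
move=> sep F FU F0 e e0.
have eM : 0 < e / 2 / M by rewrite !divr_gt0.
have [N [Nopen [z0 Sz0 Nz0] Nsmall]] := small_w_open_set eM sep.
have [U TU UP] := Tcl_of_ultra M_gt0 T_linear T_add T_bound FU F0.
have [V TV VU] := orbit_inverse TU.
have [U0 TU0 z0E] := wcl_Tcl M_gt0 T_linear T_add T_bound xs Sz0.
(* [U0 V] sends [U x] to [z0], a point of [N]; approximating it by the semigroup gives a time [r]
   with [Tstar T r (U x)] in [N]. *)
have [F2 [F2U F20 F2P]] := Tcl_ultra xs (Tcl_comp T_add TU0 TV).
have Uxs := Tcl_sun TU xs.
have VUx : V (U x) = x.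
  have [y [ys xE]] := xa; have [[TP PP] _] := Pmin.
  by have := VU P TP; rewrite {1 2}xE PP // -xE.
have [r [r0 Nr]] : exists r, 0 <= r /\ N (Tstar T r (U x)).
  have F2N : F2 [set t | N (Tstar T t (U x))].
    apply: (Nopen _ F2 _ z0) => // u; have := F2P _ Uxs u.
    by rewrite /= VUx -z0E.
  by have [r [r0 Nr]] := filter_ex (filterI F20 F2N); exists r.
(* [Tstar T r] is w*-continuous and [U x] is the limit of the orbit along [F], so [F]-most orbit
   points are moved into [N]; [orbit_bounded_below] then removes [Tstar T r]. *)
have FN : F [set t | 0 <= t /\ N (Tstar T r (orb t))].
  apply: filterI => //; apply: (Nopen _ F _ _ FU Nr) => u.
  exact: UP.
have [s [s0 Ns]] := filter_ex FN.
have Sr t : 0 <= t -> S (Tstar T r (orb t)).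
  by move=> t0; apply: (Tcl_wcl xs (Tcl_comp T_add (TT r0) (TT t0))).
exists s => //; apply: filterS FN => t [t0 Nt].
have := orbit_bounded_below r0 t0 s0 (Nsmall _ _ (Sr _ t0) (Sr _ s0) Nt Ns).
apply: ddist_le_weak; rewrite le_eqVlt; apply/orP; left; apply/eqP.
by field; rewrite gt_eqF.
Qed.

End Separable.

(** * Eigenvectors from totally bounded orbits *)

(** Each unit shift trades one term for another, at a cost of at most [2 * B]. *)
Lemma norm_shifted_sum_le (K : numDomainType) (g : nat -> K) (B : K) n q : (forall s, `|g s| <= B) ->
  `|\sum_(s < n) g (s + q)%N - \sum_(s < n) g s| <= 2 * B * q%:R.
Proof.
move=> gB; elim: q => [|q IH].
  under eq_bigr => s _ do rewrite addn0.
  by rewrite subrr normr0 mulr0.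
have -> : \sum_(s < n) g (s + q.+1)%N = \sum_(s < n) g (s + q)%N + g (n + q)%N - g q.
  apply/eqP; rewrite -subr_eq opprK addrC eq_sym.
  have <- : \sum_(s < n.+1) g (s + q)%N = \sum_(s < n) g (s + q)%N + g (n + q)%N by rewrite big_ord_recr.
  by rewrite big_ord_recl add0n; under [in eqbRHS]eq_bigr => s _ do rewrite addnS.
set a := \sum_(s < n) g (s + q)%N in IH *; set b := \sum_(s < n) g s in IH *.
rewrite addrAC -[a + _ - b]addrAC -addrA -[q.+1%:R]natr1 mulrDr mulr1.
rewrite (le_trans (ler_normD _ _)) // lerD // mulr_natl mulr2n.
by rewrite (le_trans (ler_normB _ _)) // lerD.
Qed.

Section AlmostPeriodic.
Variables (R : realType) (X : completeNormedModType R[i]) (T : R -> X -> X).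
Local Notation K := R[i].
Local Notation fX := (X -> K).
Variable M : K.
Hypothesis M_gt0 : 0 < M.
Hypothesis T_linear : forall t : R, 0 <= t -> forall (a : K) u v, T t (a *: u + v) = a *: T t u + T t v.
Hypothesis T_zero : forall u, T 0 u = u.
Hypothesis T_add : forall s t : R, 0 <= s -> 0 <= t -> forall u, T (s + t) u = T s (T t u).
Hypothesis T_bound : forall t : R, 0 <= t -> forall u, `|T t u| <= M * `|u|.

(** An element of the closure is an ultrafilter limit of the semigroup, and its eigenvalue is the
    limit of the eigenvalues at the times. *)
Lemma uni_eigen_of_orbit y : sun T y ->
  (forall t, 0 <= t -> exists2 l : K, `|l| = 1 & forall u, y (T t u) = l * y u) -> uni_eigen T y.
Proof.
move=> ys eig; split=> //.
have /choice[l lP] : forall t, exists l : K, 0 <= t -> `|l| = 1 /\ forall u, y (T t u) = l * y u.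
  move=> t; have [/eig[l l1 ly]|_] := boolP (0 <= t); last by exists 0.
  by exists l.
suff /choice[lam lamP] : forall U, exists L : K, Tcl T U ->
    `|L| = 1 /\ U y = (fun u => L * y u) by exists lam.
move=> U; have [TU|nTU] := pselect (Tcl T U); last by exists 0.
have [F [FU F0 FP]] := Tcl_ultra ys TU.
have l1 : F [set t | `|l t| = 1] by apply: filterS F0 => t /lP[].
have [L LP] : exists L, ucvg F l L.
  by apply: (@ultra_ucvg _ _ _ _ 1); apply: filterS l1 => t /= ->.
exists L => _; split; first exact: ucvg_norm_eq LP l1.
apply/funext => u; apply: ucvg_unique (FP y ys u) _ => e e0.
apply: filterS2 F0 (ucvgM LP (ucvg_cst (y u)) e0) => t t0 /=.
by have [_ ->] := lP t t0.
Qed.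

Variable x : fX.
Hypothesis xs : sun T x.
Local Notation orb t := (Tstar T t x).

Definition orbit_average n (w : K) (h : R) : fX :=
  fun u => n%:R^-1 * \sum_(t < n) w ^+ t * x (T (t%:R * h) u).

Lemma orbit_average_dominated n (w : K) (h : R) : 0 <= h -> `|w| = 1 ->
  dominated T M x (orbit_average n w h).
Proof.
move=> h0 w1; rewrite /orbit_average.
have -> : (fun u => n%:R^-1 * \sum_(t < n) w ^+ t * x (T (t%:R * h) u)) =
    (fun u => \sum_(t < n) (n%:R^-1 * w ^+ t) * Tstar T (t%:R * h) x u).
  by apply/funext => u; rewrite mulr_sumr; apply: eq_bigr => t _; rewrite mulrA.
apply: (dominated_average M_gt0) => t.
  by rewrite normrM normrX w1 expr1n mulr1 normfV normr_nat.
apply: (dominated_Tstar T_linear T_add T_bound); last exact: sun_linear xs.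
exact: mulr_ge0.
Qed.

(** Replacing [t] by the grid time [q h] just below it costs the continuity bound [d]; shifting the
    average by [q] grid steps divides it by [w ^+ q] up to boundary terms. *)
Lemma orbit_average_almost_eigen n (w : K) (h t : R) (C d : K) : (0 < n)%N -> 0 < h -> 0 <= t ->
  `|w| = 1 -> 0 <= C -> 0 <= d -> (forall u, `|x u| <= C * `|u|) ->
  (forall r, 0 <= r < h -> ddist_le (orb r) x d) ->
  forall u, `|orbit_average n w h (T t u) - (w ^+ Num.truncn (t / h))^-1 * orbit_average n w h u| <=
    (d * M + 2 * C * M * ((Num.truncn (t / h))%:R / n%:R)) * `|u|.
Proof.
move=> n0 h0 t0 w1 C0 d0 xC xd u; set q := Num.truncn (t / h).
have [qle qgt] : q%:R * h <= t /\ t < q.+1%:R * h.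
  have /truncn_itv/andP[] : 0 <= t / h by rewrite divr_ge0 // ltW.
  by rewrite -/q ler_pdivlMr // ltr_pdivrMr.
have qh0 : 0 <= q%:R * h by rewrite mulr_ge0 // ltW.
have sh0 (s : nat) : 0 <= s%:R * h by rewrite mulr_ge0 // ltW.
have nK : 0 < n%:R :> K by rewrite ltr0n.
have w0 : w != 0 by rewrite -normr_gt0 w1.
have M0 := ltW M_gt0.
pose f s := x (T (s%:R * h) u).
have fB s : `|f s| <= C * M * `|u|.
  by rewrite -mulrA (le_trans (xC _)) // ler_wpM2l // T_bound.
have shift (s : nat) : `|x (T (s%:R * h) (T t u)) - f (s + q)%N| <= d * M * `|u|.
  have rd : 0 <= t - q%:R * h < h.
    rewrite subr_ge0 qle ltrBlDl; apply: lt_le_trans qgt _.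
    by rewrite -natr1 mulrDl mul1r.
  have -> : T (s%:R * h) (T t u) = T (t - q%:R * h) (T ((s + q)%N%:R * h) u).
    case/andP: rd => rd _.
    rewrite -!T_add //; congr (T _ u); rewrite natrD; ring.
  apply: le_trans (xd _ rd _) _; by rewrite -mulrA ler_wpM2l // T_bound.
pose A := n%:R^-1 * \sum_(s < n) w ^+ s * f (s + q)%N.
have -> : orbit_average n w h (T t u) - (w ^+ q)^-1 * orbit_average n w h u =
   (orbit_average n w h (T t u) - A) + (A - (w ^+ q)^-1 * orbit_average n w h u) by ring.
apply: le_trans (ler_normD _ _) _; rewrite mulrDl; apply: lerD.
  rewrite /A -mulrBr -sumrB normrM normfV normr_nat ler_pdivrMl //.
  apply: le_trans (ler_norm_sum _ _ _) _.
  rewrite mulr_natl -[in leRHS](card_ord n) -sumr_const; apply: ler_sum => s _.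
  by rewrite -mulrBr normrM normrX w1 expr1n mul1r shift.
have -> : A - (w ^+ q)^-1 * orbit_average n w h u = (w ^+ q)^-1 * n%:R^-1 *
    (\sum_(s < n) w ^+ (s + q) * f (s + q)%N - \sum_(s < n) w ^+ s * f s).
  rewrite mulrBr; congr (_ - _); last by rewrite /orbit_average mulrA.
  rewrite -mulrA mulrCA /A; congr (_ * _); rewrite mulr_sumr; apply: eq_bigr => s _.
  by rewrite exprD mulrA [_ * w ^+ q]mulrC mulKf ?expf_neq0.
rewrite normrM normrM !normfV normrX w1 expr1n invr1 mul1r normr_nat ler_pdivrMl //.
apply: le_trans (@norm_shifted_sum_le _ (fun s => w ^+ s * f s) (C * M * `|u|) _ _ _) _.
  by move=> s; rewrite normrM normrX w1 expr1n mul1r.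
rewrite le_eqVlt; apply/orP; left; apply/eqP; field.
by rewrite gt_eqF.
Qed.

Hypothesis bounded_below : forall r t s e, 0 <= r -> 0 <= t -> 0 <= s ->
  ddist_le (Tstar T r (orb t)) (Tstar T r (orb s)) e -> ddist_le (orb t) (orb s) (M * e).
Hypothesis tb : totally_bounded_orbit T x.

Definition near_returns n (h : R) (e : K) : {set 'I_n} :=
  [set s : 'I_n | `[< ddist_le (orb (s%:R * h)) x e >]]%SET.

(** Pigeonhole: a finite net sorts the grid times into [p] classes, with [p] independent of the
    grid. Subtracting its least time maps a class injectively into the near returns, because
    [bounded_below] cancels the common [Tstar T (s0 h)]. *)
Lemma near_returns_frequent (e : K) : 0 < e -> exists2 p, (0 < p)%N &
  forall n h, 0 <= h -> (n <= p * #|near_returns n h e|)%N.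
Proof.
move=> e0; have eM : 0 < e / 2 / M by rewrite !divr_gt0.
have [p [c [c0 cP]]] := tb eM.
have p0 : (0 < p)%N by have [i _] := cP 0 (lexx 0); exact: leq_ltn_trans (ltn_ord i).
exists p => // n h h0; set A := near_returns n h e.
have sh0 (s : nat) : 0 <= s%:R * h by rewrite mulr_ge0.
have /choice[f fP] : forall s : 'I_n, exists i, ddist_le (orb (s%:R * h)) (orb (c i)) (e / 2 / M).
  by move=> s; apply: cP.
have nE : n = (\sum_(i < p) \sum_(s < n | f s == i) 1)%N.
  by rewrite -[LHS]card_ord -sum1_card (partition_big f xpredT).
rewrite [leqLHS]nE -[p in leqRHS]card_ord -sum_nat_const; apply: leq_sum => i _.
rewrite sum1dep_card; set B : {set 'I_n} := finset.finset _.
have [->|[s1 s1B]] := set_0Vmem B; first by rewrite cards0.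
case: (@arg_minnP _ s1 (fun s => s \in B) (@nat_of_ord n) s1B) => s0 s0B s0min.
pose g (s : 'I_n) : 'I_n := Ordinal (leq_ltn_trans (leq_subr s0 s) (ltn_ord s)).
have ginj : {in B &, injective g}.
  move=> s t sB tB [] /eqP.
  by rewrite -(eqn_add2r s0) !subnK ?s0min // => /eqP/val_inj.
rewrite -(card_in_imset ginj) subset_leq_card //.
apply/fintype.subsetP => _ /finset.imsetP[s sB ->]; rewrite inE; apply/asboolP => /=.
move: sB s0B (s0min s sB); rewrite !inE => /eqP fs /eqP fs0 s0s.
have orb0 : x = orb 0 by apply/funext => u; rewrite /Tstar T_zero.
have near_s := fP s; have near_s0 := fP s0; rewrite fs in near_s; rewrite fs0 in near_s0.
have close := ddist_le_trans near_s (ddist_le_sym near_s0).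
have E1 : orb (s%:R * h) = Tstar T (s0%:R * h) (orb ((s - s0)%N%:R * h)).
  by apply/funext => u; rewrite /Tstar -T_add // -mulrDl -natrD subnK.
have E2 : orb (s0%:R * h) = Tstar T (s0%:R * h) (orb 0).
  by apply/funext => u; rewrite /Tstar T_zero.
rewrite E1 E2 in close.
have := bounded_below (sh0 s0) (sh0 _) (lexx 0) close; rewrite -orb0.
by apply: ddist_le_weak; rewrite le_eqVlt; apply/orP; left; apply/eqP; field; rewrite gt_eqF.
Qed.

(** Composing two near returns costs [e] for one and [M * e] for the other. *)
Lemma near_returns_average n h (e : K) (A := near_returns n h e) : 0 <= h -> 0 <= e -> (0 < #|A|)%N ->
  forall u, `|x u - #|A|%:R ^- 2 * (\sum_(s in A) \sum_(s' in A) x (T ((s + s')%N%:R * h) u))| <=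
    (M + 1) * e * `|u|.
Proof.
move=> h0 e0 A0 u; have M0 := ltW M_gt0.
have sh0 (s : nat) : 0 <= s%:R * h by rewrite mulr_ge0.
have AK : 0 < #|A|%:R :> K by rewrite ltr0n.
have close s s' : s \in A -> s' \in A ->
    `|x u - x (T ((s + s')%N%:R * h) u)| <= (M + 1) * e * `|u|.
  rewrite !inE => sA s'A.
  rewrite natrD [(_ + _) * h]mulrDl T_add //.
  have -> : (M + 1) * e * `|u| = e * `|u| + M * e * `|u| by ring.
  rewrite (le_trans (ler_distD (x (T (s'%:R * h) u)) _ _)) // lerD //.
    by rewrite distrC; exact: (s'A u).
  rewrite distrC; apply: le_trans (sA (T (s'%:R * h) u)) _.
  by rewrite [M * e]mulrC -mulrA ler_wpM2l // T_bound.
rewrite -(ler_pM2l (exprn_gt0 2 AK)) -{1}[_ ^+ 2]ger0_norm ?exprn_ge0 // -normrM mulrBr.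
rewrite mulVKf ?expf_neq0 ?gt_eqF //.
have const y : #|A|%:R ^+ 2 * y = \sum_(s in A) \sum_(s' in A) y :> K.
  by rewrite !sumr_const -mulrnA -[in RHS]mulr_natl natrM expr2.
rewrite !const -sumrB (le_trans (ler_norm_sum _ _ _)) //; apply: ler_sum => s sA.
rewrite -sumrB (le_trans (ler_norm_sum _ _ _)) //; apply: ler_sum => s' s'A.
exact: close.
Qed.

Lemma orbit_average_approximation (e : K) : 0 < e -> exists m, forall (n : nat) (h : R), 0 <= h ->
  exists k w : 'I_m -> K, [/\ forall i, `|k i| <= 1, forall i, `|w i| = 1 &
    ddist_le x (fun u => \sum_i k i * orbit_average (2 ^ n.+1)%N (w i) h u) e].
Proof.
move=> e0; have M0 := ltW M_gt0.
have [yd _] := xs; have [C C0 xC] := dualel_bound yd.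
(* These make the near-return error and the Fourier error [e / 2] each. *)
pose e1 := e / 2 / (M + 1); pose eta := e / 2 / (C * M).
have M1 : 0 < M + 1 by rewrite ltr_wpDl.
have CM : 0 < C * M by rewrite mulr_gt0.
have e10 : 0 < e1 by rewrite !divr_gt0.
have eta0 : 0 < eta by rewrite !divr_gt0.
have [p p0 pP] := near_returns_frequent e10.
have pK : 0 < p%:R :> K by rewrite ltr0n.
(* Near returns are sought among [2 ^ n] of the [2 ^ n.+1] grid times, hence the factor 2. *)
pose c : K := (2 * p%:R)^-1.
have c0 : 0 < c by rewrite invr_gt0 mulr_gt0.
have th0 := mulr_gt0 (exprn_gt0 2 eta0) (exprn_gt0 3 c0).
have [m mP] := invn_lt th0.
exists m.+1 => n h h0.
have [w pw] := prim_root_two_power K n; rewrite expnS in pw.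
set A := near_returns (2 ^ n) h e1.
have cA : c * (2 * 2 ^ n)%N%:R <= #|A|%:R.
  rewrite /c natrM invfM mulrACA mulVf ?mul1r ?pnatr_eq0 //.
  by rewrite ler_pdivrMl // -natrM ler_nat pP.
have A0 : (0 < #|A|)%N.
  rewrite -(ltr_nat K); apply: lt_le_trans cA.
  by rewrite mulr_gt0 // ltr0n muln_gt0 expn_gt0.
have mP' : (eta ^+ 2 * c ^+ 3)^-1 <= m.+1%:R.
  by rewrite -[leRHS]invrK lef_pV2 ?posrE ?invr_gt0 ?th0 ?ltr0n // (ltW mP).
have [j [k [k1 kP]]] := fourier_approximation pw c0 eta0 cA mP'.
exists k, (fun i => w ^+ (j i)); split=> // [i|].
  by rewrite normrX (normr_prim_root pw) expr1n.
move=> u; rewrite [e](splitr e) mulrDl.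
have -> : e / 2 = (M + 1) * e1 by rewrite /e1 mulrCA mulfV ?mulr1 // gt_eqF.
pose f s := x (T (s%:R * h) u).
apply: le_trans (ler_distD (#|A|%:R ^- 2 *
   (\sum_(s in A) \sum_(s' in A) f (s + s')%N)) _ _) _.
apply: lerD; first exact: (near_returns_average h0 (ltW e10) A0 u).
have fB t : (t < 2 * 2 ^ n)%N -> `|f t| <= C * M * `|u|.
  by move=> _; rewrite -mulrA (le_trans (xC _)) // ler_wpM2l ?(ltW C0) // T_bound // mulr_ge0.
have := kP f _ fB; rewrite mulrA (_ : eta * (C * M) = (M + 1) * e1); last first.
  by rewrite /eta /e1; field; rewrite !gt_eqF.
apply: le_trans; rewrite le_eqVlt; apply/orP; left; apply/eqP; congr `|_ - _|.
apply: eq_bigr => i _; rewrite /orbit_average expnS; do 2![congr (_ * _)].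
by apply: eq_bigr => t _; rewrite -exprM.
Qed.

Lemma totally_bounded_sun_uds : sun_uds T x.
Proof.
split=> // e e0.
have [yd xmod] := xs; have [C C0 xC] := dualel_bound yd.
have M0 := ltW M_gt0.
have [m mP] := orbit_average_approximation e0.
(* The mesh tends to 0 while the [2 ^ (n + n).+1] grid times span a length [2 ^ n.+1] tending to
   infinity; [m] is fixed, so the limit is a combination of [m] terms. *)
pose h n : R := (2 ^ n)%:R^-1.
have h0 n : 0 < h n by rewrite invr_gt0 ltr0n expn_gt0.
have /choice[kw kwP] : forall n, exists kw : ('I_m -> K) * ('I_m -> K),
    [/\ forall i, `|kw.1 i| <= 1, forall i, `|kw.2 i| = 1 &
    ddist_le x (fun u => \sum_i kw.1 i * orbit_average (2 ^ (n + n).+1)%N (kw.2 i) (h n) u) e].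
  by move=> n; have [k [w kwP]] := mP (n + n)%N (h n) (ltW (h0 n)); exists (k, w).
pose Y n i := orbit_average (2 ^ (n + n).+1)%N ((kw n).2 i) (h n).
have [F [FU Fev]] := ultraFilterLemma (@eventually_filter).
have hF r : 0 < r -> F [set n | h n < r].
  move=> r0; apply: Fev; exists (Num.truncn r^-1) => // n /= rn.
  rewrite /h invf_plt ?posrE ?ltr0n ?expn_gt0 //.
  apply: lt_le_trans (truncnS_gt _) _; rewrite ler_nat.
  exact: leq_ltn_trans rn (ltn_expl _ _).
have w1 n i : `|(kw n).2 i| = 1 by have [] := kwP n.
have Ydom n i : dominated T M x (Y n i) by apply: orbit_average_dominated => //; exact: ltW.
have /choice[y yP] : forall i, exists y : fX, forall u, ucvg F (fun n => Y n i u) (y u).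
  move=> i; suff /choice[yi yiP] : forall u, exists l, ucvg F (fun n => Y n i u) l by exists yi.
  move=> u; apply: (@ultra_ucvg _ _ _ _ (M * C * `|u|)).
  by apply: filterE => n; have [_ + _] := Ydom n i; apply => //; exact: ltW.
have /choice[c cP] : forall i, exists c, ucvg F (fun n => (kw n).1 i) c.
  move=> i; apply: (@ultra_ucvg _ _ _ _ 1).
  by apply: filterE => n /=; have [] := kwP n.
have ys i : sun T (y i).
  apply: (dominated_sun M_gt0 xs); apply: dominated_ulim (yP i).
  by apply: filterE => n /=.
exists m, c, y; split; last first.
  move=> u; apply: ucvg_norm_le (ucvgB (ucvg_cst (x u)) (ucvg_sum (fun i => ucvgM (cP i) (yP i u)))) _.
  by apply: filterE => n /=; have [_ _] := kwP n; apply.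
move=> i; apply: uni_eigen_of_orbit => // t t0.
pose l n := ((kw n).2 i ^+ Num.truncn (t / h n))^-1.
have l1 n : `|l n| = 1 by rewrite normfV normrX w1 expr1n invr1.
have [L LP] : exists L, ucvg F l L.
  by apply: (@ultra_ucvg _ _ _ _ 1); apply: filterE => n /=; rewrite l1.
exists L; first by apply: ucvg_norm_eq LP _; apply: filterE.
move=> u; apply/eqP; rewrite -subr_eq0; apply/eqP.
apply: ucvg_unique (ucvgB (yP i (T t u)) (ucvgM LP (yP i u))) _ => d d0.
rewrite /=.
have u1 : 0 < `|u| + 1 by rewrite ltr_wpDl.
(* [d1] and [q] allot [d / 2] each to the continuity error and the boundary error; [|u| + 1] avoids
   a division by 0. *)
pose d1 := d / 2 / (M * (`|u| + 1)).
have d10 : 0 < d1 by rewrite !divr_gt0 // mulr_gt0.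
have [r [r0 rP]] := xmod d1 d10.
have [q q0 qE] : exists2 q : R, 0 < q & d / 2 / (2 * C * M * (`|u| + 1)) = q%:C.
  by apply: ltr0_complex; rewrite !divr_gt0 // !mulr_gt0.
have t1 : 0 < t + 1 by rewrite ltr_wpDl.
apply: filterS2 (hF r r0) (hF (q / (t + 1)) (divr_gt0 q0 t1)) => n /= hr hq.
have xr s : 0 <= s < h n -> ddist_le (orb s) x d1.
  case/andP; rewrite le_eqVlt => /orP[/eqP <- _ v|s0 sh].
    by rewrite /Tstar T_zero subrr normr0 mulr_ge0 // ltW.
  by apply: rP; rewrite s0 (lt_trans sh hr).
have N0 : (0 < 2 ^ (n + n).+1)%N by rewrite expn_gt0.
have := orbit_average_almost_eigen N0 (h0 n) t0 (w1 n i) (ltW C0) (ltW d10) xC xr u.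
rewrite subr0 => /le_lt_trans; apply.
have trunc_le : (Num.truncn (t / h n))%:R / (2 ^ (n + n).+1)%:R <= q%:C.
  have -> : (Num.truncn (t / h n))%:R / (2 ^ (n + n).+1)%:R =
      ((Num.truncn (t / h n))%:R / (2 ^ (n + n).+1)%:R : R)%:C.
    by rewrite rmorphM fmorphV !rmorph_nat.
  rewrite lecR.
  have th0 : 0 <= t / h n by rewrite divr_ge0 // ltW.
  apply: le_trans (_ : t / h n / (2 ^ (n + n).+1)%:R <= _).
    by rewrite ler_pM2r ?invr_gt0 ?ltr0n // truncn_le.
  apply: le_trans (_ : t * h n <= _).
    rewrite -mulrA ler_wpM2l // /h invrK ler_pdivrMr ?ltr0n //.
    rewrite mulrC ler_pdivlMr ?ltr0n ?expn_gt0 // -natrM ler_nat -expnD.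
    by rewrite leq_exp2l.
  rewrite ltr_pdivlMr // in hq; apply: le_trans (ltW hq).
  by rewrite mulrC ler_pM2l // lerDl.
apply: le_lt_trans (_ : (d1 * M + 2 * C * M * q%:C) * `|u| < d).
  by rewrite ler_wpM2r // lerD2l ler_pM2l // !mulr_gt0.
apply: lt_le_trans (_ : (d1 * M + 2 * C * M * q%:C) * (`|u| + 1) <= d).
  rewrite ltr_pM2l ?ltrDl // ltr_wpDr ?(mulr_gt0 d10 M_gt0) //.
  by rewrite !mulr_ge0 ?(ltW C0) // ler0c ltW.
rewrite -qE /d1 le_eqVlt; apply/orP; left; apply/eqP; field.
by rewrite !gt_eqF.
Qed.

End AlmostPeriodic.

Theorem theorem4p8 (R : realType) (X : completeNormedModType R[i])
  (T : R -> X -> X) (P : (X -> R[i]) -> (X -> R[i])) (x : X -> R[i]) :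
  bounded_C0_semigroup T ->
  Tcl_abelian T ->
  Tcl_minimal_idempotent T P ->
  sun_a T P x ->
  (norm_separable (wcl T (sg_orbit T x)) <-> sun_uds T x) /\
  (sun_uds T x <-> rel_ncompact T (sg_orbit T x)).
Proof.
move=> [T_lin T_zero T_add _ [M0 M0P]] Tabel Pmin xa.
(* [M0] carries no sign condition; the later arguments use a positive bound. *)
pose M : R[i] := `|M0| + 1.
have M_gt0 : 0 < M by rewrite ltr_wpDl.
have T_linear t : 0 <= t -> forall (a : R[i]) u v, T t (a *: u + v) = a *: T t u + T t v.
  by move=> /T_lin[].
have T_bound t : 0 <= t -> forall u, `|T t u| <= M * `|u|.
  move=> t0 u; apply: le_trans (M0P t t0 u) _.
  have : 0 <= M0 * `|u| by rewrite (le_trans _ (M0P t t0 u)).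
  by move=> /ger0_norm <-; rewrite normrM normr_id ler_wpM2r // lerDl.
have xs := sun_a_sun Pmin xa.
have below := orbit_bounded_below M_gt0 T_linear T_add T_bound Tabel Pmin xa.
have tb_uds : totally_bounded_orbit T x -> sun_uds T x.
  exact: (totally_bounded_sun_uds M_gt0 T_linear T_zero T_add T_bound xs below).
have uds_tb : sun_uds T x -> totally_bounded_orbit T x.
  move=> uds; apply: ultra_cauchy_totally_bounded.
  exact: (sun_uds_ultra_cauchy M_gt0 T_linear T_add T_bound).
split; split.
- move=> sep; apply: tb_uds; apply: ultra_cauchy_totally_bounded.
  exact: (separable_ultra_cauchy M_gt0 T_linear T_add T_bound Tabel Pmin xa sep).
- by move=> /uds_tb; apply: (totally_bounded_separable M_gt0 T_linear T_add T_bound xs).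
- by move=> /uds_tb; apply: (totally_bounded_rel_ncompact M_gt0 T_linear T_zero T_add T_bound xs).
- by move=> /(rel_ncompact_totally_bounded M_gt0 T_linear T_add T_bound xs).
Qed.
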